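(* Let $K$ be the figure 8 knot. The leading order large $r$ asymptotics of the (normalized) colored Jones polynomial of $K$ evaluated at the top color $\lambda=r$ is given by $$J_K'(r)\sim 3^{-1/4}\,r^{3/2}\exp\left(\frac{r}{2\pi}\mathrm{Vol}(K)\right)\qquad (r\to\infty).$$
   Context: For an integer $r\ge 2$ put $\xi=\exp(2\pi\sqrt{-1}/r)$. For the figure 8 knot $K\subset S^3$ and a color $\lambda\in\{1,\dots,r\}$, the normalized colored Jones polynomial (normalized to be $1$ on the unknot, zero framing) at level $r$ is $$J_K'(\lambda)=\sum_{m=0}^{\lambda-1}\xi^{-m\lambda}\prod_{l=1}^{m}(1-\xi^{\lambda-l})(1-\xi^{\lambda+l}),$$ where the empty product ($m=0$) is $1$. $\mathrm{Vol}(K)$ is the hyperbolic volume of $S^3\setminus K$; explicitly $\mathrm{Vol}(K)=2\,\mathrm{Cl}_2(\pi/3)$ with $\mathrm{Cl}_2(\theta)=\sum_{n\ge1}\sin(n\theta)/n^2$. The relation $f(r)\sim g(r)$ means $f(r)/g(r)\to1$ as $r\to\infty$. *)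

(* Defs.v *)
From Stdlib Require Export Reals List.
From Coquelicot Require Export Coquelicot.
Open Scope R_scope.

Definition Cexp (z : C) : C :=
  (RtoC (exp (Re z)) * (RtoC (cos (Im z)) + Ci * RtoC (sin (Im z))))%C.

(** Product of [f i] over [a <= i <= b], equal to [1] when [b < a]. *)
Definition Cprod (a b : nat) (f : nat -> C) : C :=
  fold_right Cmult (RtoC 1) (map f (seq a (S b - a))).

Definition xi (r : nat) : C :=
  Cexp (RtoC 2 * RtoC PI * Ci / RtoC (INR r))%C.

(** Normalized colored Jones polynomial of the figure 8 knot (value 1 on the
    unknot, zero framing) at level [r] and color [lambda], in the
    cyclotomic-expansion form; meaningful for [2 <= r] and
    [1 <= lambda <= r].  The natural-number subtractions do not truncate for
    such [lambda], since [1 <= l <= m <= lambda - 1]. *)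
Definition colored_Jones_fig8 (r lambda : nat) : C :=
  sum_n (fun m : nat =>
    (/ xi r ^ (m * lambda) *
     Cprod 1 m (fun l : nat =>
       (1 - xi r ^ (lambda - l)) * (1 - xi r ^ (lambda + l))))%C)
    (lambda - 1).

(** The index is shifted: the sum over [n >= 1] of [sin (n theta) / n^2]. *)
Definition Cl2 (theta : R) : R :=
  Series (fun n : nat => sin (INR (S n) * theta) / INR (S n) ^ 2).

(** Hyperbolic volume of the figure 8 knot complement: two regular ideal
    tetrahedra, each of volume [Cl2 (PI / 3)]. *)
Definition Vol_fig8 : R := 2 * Cl2 (PI / 3).

(** Meant for [g] that is eventually nonzero, since [Cdiv] is total. *)
Definition asymp_equiv (f g : nat -> C) : Prop :=
  filterlim (fun r : nat => (f r / g r)%C) eventually (locally (RtoC 1)).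

(* Main.v *)
Require Import Defs.
From Stdlib Require Import Reals List Lra Lia FinFun.
From Coquelicot Require Import Coquelicot.

(** At the top color the root of unity satisfies [xi r ^ r = 1], so the two
    factors of the cyclotomic expansion become complex conjugates and the
    invariant is a sum of positive terms: with [s_l = 2 sin (PI l / r)] and
    [P_m = s_1 ... s_m], it equals the sum of [P_m ^ 2] over [m < r]
    ([colored_Jones_top]).  The factors exceed 1 exactly for
    [r / 6 < l < 5 r / 6], so [P_m] peaks at [m] near [5 r / 6], and the sum is
    evaluated by Laplace's method there.

    The value of the peak comes from the potential
    [Phi x = - Cl2 (2 PI x) / (2 PI)], a primitive of
    [x |-> ln (2 sin (PI x))] on the open unit interval
    ([is_derive_potential]).  The logarithm of [P_m] is a sum of values of this
    derivative with spacing [1 / r], but it is singular at 0, where the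
    sum cannot be compared with an integral without a Stirling correction.
    The singularity is removed by the identity [P_m * P_(r - 1 - m) = r]
    ([sine_prod_reflect], from the factorization of [1 + x + ... + x ^ (r - 1)]
    at [x = 1]): it turns [P_m ^ 2 / r] into [P_m / P_(r - 1 - m)], a product
    over indices symmetric about [r / 2] and, for [m] near [5 r / 6], bounded
    away from both ends.  The midpoint rule then gives
    [P_m ^ 2 = r * exp (2 r Phi ((m + 1/2) / r) + O (1 / r))]
    ([sine_prod_sqr_estimate]).

    At [5 / 6] the potential has a critical point with
    [2 Phi (5 / 6) = Vol_fig8 / (2 PI)] and second derivative [- PI sqrt 3], so
    the normalized summands are squeezed between Gaussians of parameters [k1]
    and [k2] arbitrarily close to [PI sqrt 3], up to an exponentially small
    error obtained away from the peak from the monotonicity of [P_m]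
    ([normalized_summand_bounds]).  The Gaussian sums are again evaluated by the
    midpoint rule, and grow like [sqrt (PI r / k)] ([gauss_sum_lim]).  At
    [k = PI sqrt 3] this is [3 ^ (- 1/4) * sqrt r]; the factor [r] of
    [P_m ^ 2] supplies the rest of the power [3 / 2]. *)

(** * Increments, the midpoint rule and finite sums *)

Lemma exp_monotone (x y : R) : x <= y -> exp x <= exp y.
Proof. intros [H | ->]; [left; now apply exp_increasing | lra]. Qed.

Lemma sum_n_step (f : nat -> R) (n : nat) : sum_n f (S n) = sum_n f n + f (S n).
Proof. exact (sum_Sn f n). Qed.

Lemma sum_n_le_compat (f g : nat -> R) (N : nat) :
  (forall m, (m <= N)%nat -> f m <= g m) -> sum_n f N <= sum_n g N.
Proof.
  induction N as [| N IH]; intros H.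
  - rewrite !sum_O. apply H. lia.
  - rewrite !sum_n_step. apply Rplus_le_compat. apply IH. intros; apply H; lia. apply H; lia.
Qed.

Lemma sum_n_plus_const (f : nat -> R) (e : R) (N : nat) :
  sum_n f N + INR (S N) * e = sum_n (fun m => f m + e) N.
Proof.
  induction N as [| N IH].
  - rewrite !sum_O. simpl. ring.
  - rewrite !sum_n_step, <- IH, (S_INR (S N)). ring.
Qed.

Lemma sum_n_scal (f : nat -> R) (c : R) (N : nat) : sum_n (fun m => c * f m) N = c * sum_n f N.
Proof. exact (sum_n_mult_l (K := R_Ring) c f N). Qed.

Lemma inv_INR_lim : is_lim_seq (fun r => / INR r) 0.
Proof.
  replace (Finite 0) with (Rbar_inv p_infty) by reflexivity.
  apply is_lim_seq_inv. apply is_lim_seq_INR. discriminate.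
Qed.

Lemma is_lim_seq_sqrt_INR : is_lim_seq (fun r => sqrt (INR r)) p_infty.
Proof. apply (filterlim_comp _ _ _ INR sqrt _ _ _ is_lim_seq_INR). apply filterlim_sqrt_p. Qed.

Lemma inv_sqrt_INR_lim : is_lim_seq (fun r => / sqrt (INR r)) 0.
Proof.
  replace (Finite 0) with (Rbar_inv p_infty) by reflexivity.
  apply is_lim_seq_inv. apply is_lim_seq_sqrt_INR. discriminate.
Qed.

Lemma mean_value (f df : R -> R) (a b : R) :
  (forall x, Rmin a b <= x <= Rmax a b -> is_derive f x (df x)) ->
  exists c, Rmin a b <= c <= Rmax a b /\ f b - f a = df c * (b - a).
Proof.
  intros H.
  destruct (MVT_gen f a b df) as [c Hc].
  - intros x Hx. apply H. lra.
  - intros x Hx. apply continuity_pt_filterlim.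
    apply (ex_derive_continuous f x). exists (df x). now apply H.
  - now exists c.
Qed.

Lemma increment_bound (f df : R -> R) (a b B : R) :
  (forall x, Rmin a b <= x <= Rmax a b -> is_derive f x (df x)) ->
  (forall x, Rmin a b <= x <= Rmax a b -> Rabs (df x) <= B) ->
  Rabs (f b - f a) <= B * Rabs (b - a).
Proof.
  intros H HB. destruct (mean_value f df a b H) as [c [Hc E]].
  rewrite E, Rabs_mult. apply Rmult_le_compat_r; [apply Rabs_pos | now apply HB].
Qed.

(** Stated for a bound on the second difference of [g], rather than on its
    second derivative, because for [ln (2 sin (PI x))] that difference has a
    closed form.  The proof differentiates in [h]. *)
Lemma midpoint_rule_error (F g : R -> R) (x h lo hi : R) :
  0 <= h ->
  (forall y, x - h <= y <= x + h -> is_derive F y (g y)) ->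
  (forall s, 0 <= s <= h -> lo <= g (x + s) + g (x - s) - 2 * g x <= hi) ->
  lo * h <= F (x + h) - F (x - h) - 2 * h * g x <= hi * h.
Proof.
  intros Hh HF Hb.
  destruct (mean_value (fun s => F (x + s) - F (x - s) - 2 * s * g x)
              (fun s => g (x + s) + g (x - s) - 2 * g x) 0 h) as [c [Hc E]].
  - rewrite Rmin_left, Rmax_right by lra. intros s Hs.
    assert (H1 : is_derive (fun s => F (x + s)) s (g (x + s))).
    { evar_last. apply (is_derive_comp F (fun s => x + s)).
      apply HF; lra. auto_derive. exact I. reflexivity.
      unfold scal; simpl; unfold mult; simpl; ring. }
    assert (H2 : is_derive (fun s => F (x - s)) s (- g (x - s))).
    { evar_last. apply (is_derive_comp F (fun s => x - s)).
      apply HF; lra. auto_derive. exact I. reflexivity.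
      unfold scal; simpl; unfold mult; simpl; ring. }
    assert (H3 : is_derive (fun s => 2 * s * g x) s (2 * g x)).
    { auto_derive. exact I. ring. }
    evar_last.
    apply (is_derive_minus (fun s => F (x + s) - F (x - s)) (fun s => 2 * s * g x)).
    apply (is_derive_minus (fun s => F (x + s)) (fun s => F (x - s))).
    exact H1. exact H2. exact H3.
    unfold minus, plus, opp; simpl. ring.
  - rewrite Rmin_left, Rmax_right in Hc by lra.
    rewrite !Rplus_0_r, !Rminus_0_r in E.
    replace (F (x + h) - F (x - h) - 2 * h * g x)
      with ((g (x + c) + g (x - c) - 2 * g x) * h) by lra.
    specialize (Hb c Hc). nra.
Qed.

(** * The Gaussian integral *)

Definition gauss (x : R) : R := exp (- x ^ 2).
Definition gauss_prim (x : R) : R := RInt gauss 0 x.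

Lemma continuous_gauss (x : R) : continuous gauss x.
Proof. apply (ex_derive_continuous gauss). unfold gauss. auto_derive. exact I. Qed.

Lemma ex_RInt_gauss (a b : R) : ex_RInt gauss a b.
Proof. apply (ex_RInt_continuous (V := R_CompleteNormedModule)). intros; apply continuous_gauss. Qed.

Lemma is_derive_gauss_prim (x : R) : is_derive gauss_prim x (gauss x).
Proof.
  apply (is_derive_RInt gauss gauss_prim 0 x).
  - apply filter_forall. intros b. apply (RInt_correct (V := R_CompleteNormedModule)). apply ex_RInt_gauss.
  - apply continuous_gauss.
Qed.

Lemma gauss_prim_0 : gauss_prim 0 = 0.
Proof. unfold gauss_prim. now rewrite RInt_point. Qed.

Lemma gauss_prim_opp (x : R) : gauss_prim (- x) = - gauss_prim x.
Proof.
  unfold gauss_prim.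
  assert (H : is_RInt gauss 0 (- x) (opp (RInt gauss 0 x))).
  { apply is_RInt_ext with (fun y => opp (opp (gauss (- - y)))).
    - intros y _. rewrite opp_opp. unfold gauss. now rewrite Ropp_involutive.
    - apply (is_RInt_opp (fun y => opp (gauss (- - y)))).
      apply (is_RInt_comp_opp (fun y => gauss (- y))).
      rewrite Ropp_0, Ropp_involutive.
      apply is_RInt_ext with gauss.
      + intros y _. unfold gauss. f_equal. ring.
      + apply (RInt_correct (V := R_CompleteNormedModule)). apply ex_RInt_gauss. }
  exact (is_RInt_unique (V := R_CompleteNormedModule) _ _ _ _ H).
Qed.

(** The function [gauss_prim x ^ 2 + gauss_companion x] is constant: the
    derivative of this parametric integral cancels that of the square.
    Comparing [x = 0], where the integral is [atan 1], with [x] at infinity,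
    where it vanishes, gives the Gaussian integral. *)
Definition gauss_companion (x : R) : R :=
  RInt (fun t => exp (- x ^ 2 * (1 + t ^ 2)) / (1 + t ^ 2)) 0 1.

Lemma one_plus_sqr_pos (t : R) : 0 < 1 + t ^ 2.
Proof. nra. Qed.

Lemma ex_RInt_gauss_companion (x a b : R) :
  ex_RInt (fun t => exp (- x ^ 2 * (1 + t ^ 2)) / (1 + t ^ 2)) a b.
Proof.
  apply (ex_RInt_continuous (V := R_CompleteNormedModule)). intros t _.
  apply (ex_derive_continuous (fun t => exp (- x ^ 2 * (1 + t ^ 2)) / (1 + t ^ 2))). auto_derive.
  apply Rgt_not_eq. generalize (one_plus_sqr_pos t). simpl. lra.
Qed.

Lemma Derive_companion_integrand (x t : R) :
  is_derive (fun u => exp (- u ^ 2 * (1 + t ^ 2)) / (1 + t ^ 2)) x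
    (- 2 * x * exp (- x ^ 2 * (1 + t ^ 2))).
Proof.
  generalize (one_plus_sqr_pos t); intros H.
  auto_derive. exact I. simpl in *. field. lra.
Qed.

Lemma is_derive_gauss_companion (x : R) :
  is_derive gauss_companion x (- 2 * gauss x * gauss_prim x).
Proof.
  evar_last.
  apply (is_derive_RInt_param (fun x t => exp (- x ^ 2 * (1 + t ^ 2)) / (1 + t ^ 2))).
  - apply filter_forall. intros y t _. eexists. apply Derive_companion_integrand.
  - intros t _.
    apply continuity_2d_pt_ext with (fun u v => - 2 * u * exp (- u ^ 2 * (1 + v ^ 2))).
    + intros u v. symmetry. apply is_derive_unique, Derive_companion_integrand.
    + apply continuity_2d_pt_mult.
      * apply continuity_2d_pt_mult. apply continuity_2d_pt_const. apply continuity_2d_pt_id1.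
      * apply (continuity_1d_2d_pt_comp exp).
        { apply continuity_pt_filterlim, continuous_exp. }
        apply continuity_2d_pt_mult.
        { apply continuity_2d_pt_opp. simpl. apply continuity_2d_pt_mult.
          apply continuity_2d_pt_id1. apply continuity_2d_pt_mult.
          apply continuity_2d_pt_id1. apply continuity_2d_pt_const. }
        apply continuity_2d_pt_plus. apply continuity_2d_pt_const.
        simpl. apply continuity_2d_pt_mult.
        apply continuity_2d_pt_id2. apply continuity_2d_pt_mult.
        apply continuity_2d_pt_id2. apply continuity_2d_pt_const.
  - apply filter_forall. intros y. apply ex_RInt_gauss_companion.
  - (* the substitution [t |-> x * t] turns the integral into [gauss_prim x] *)
    rewrite (RInt_ext _ (fun t => scal (- 2 * gauss x) (scal x (gauss (x * t + 0))))).
    + rewrite (RInt_scal (V := R_CompleteNormedModule) (fun t => scal x (gauss (x * t + 0)))).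
      * rewrite (RInt_comp_lin (V := R_CompleteNormedModule) gauss) by apply ex_RInt_gauss.
        replace (x * 0 + 0) with 0 by ring. replace (x * 1 + 0) with x by ring.
        reflexivity.
      * apply (ex_RInt_comp_lin gauss). apply ex_RInt_gauss.
    + intros t _. transitivity (- 2 * x * exp (- x ^ 2 * (1 + t ^ 2))).
      { apply is_derive_unique, Derive_companion_integrand. }
      replace (- x ^ 2 * (1 + t ^ 2)) with (- x ^ 2 + - (x * t + 0) ^ 2) by ring.
      rewrite exp_plus. fold (gauss x) (gauss (x * t + 0)).
      unfold scal; simpl; unfold mult; simpl. ring.
Qed.

Lemma gauss_companion_0 : gauss_companion 0 = PI / 4.
Proof.
  unfold gauss_companion.
  assert (H : is_RInt (fun t => exp (- 0 ^ 2 * (1 + t ^ 2)) / (1 + t ^ 2)) 0 1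
                (minus (atan 1) (atan 0))).
  { apply (is_RInt_derive atan).
    - intros t _. evar_last. apply is_derive_atan.
      replace (- 0 ^ 2 * (1 + t ^ 2)) with 0 by ring. rewrite exp_0.
      unfold Rsqr. field. nra.
    - intros t _. apply (ex_derive_continuous (fun t => exp (- 0 ^ 2 * (1 + t ^ 2)) / (1 + t ^ 2))).
      auto_derive. nra. }
  rewrite (is_RInt_unique (V := R_CompleteNormedModule) _ _ _ _ H), atan_0, atan_1.
  unfold minus, plus, opp; simpl. ring.
Qed.

Lemma gauss_companion_bound (x : R) : 0 <= gauss_companion x <= gauss x.
Proof.
  assert (H : forall t, 0 <= exp (- x ^ 2 * (1 + t ^ 2)) / (1 + t ^ 2) <= gauss x).
  { intros t. generalize (one_plus_sqr_pos t); intros Ht. split.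
    - apply Rdiv_le_0_compat; [left; apply exp_pos | assumption].
    - apply Rle_div_l; [assumption |].
      apply Rle_trans with (gauss x * 1).
      + rewrite Rmult_1_r. unfold gauss.
        destruct (Req_dec (x * t) 0) as [E | E].
        * right. f_equal. replace (- x ^ 2 * (1 + t ^ 2)) with (- x ^ 2 - (x * t) ^ 2) by ring.
          rewrite E. ring.
        * left. apply exp_increasing.
          replace (- x ^ 2 * (1 + t ^ 2)) with (- x ^ 2 - (x * t) ^ 2) by ring.
          assert (0 < (x * t) ^ 2) by (apply pow2_gt_0; assumption). lra.
      + apply Rmult_le_compat_l. left; apply exp_pos. nra. }
  unfold gauss_companion. split.
  - apply RInt_ge_0. lra. apply ex_RInt_gauss_companion. intros; apply H.
  - replace (gauss x) with (RInt (fun _ => gauss x) 0 1).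
    + apply RInt_le. lra. apply ex_RInt_gauss_companion. apply ex_RInt_const. intros; apply H.
    + rewrite RInt_const. unfold scal; simpl; unfold mult; simpl. ring.
Qed.

Lemma gauss_prim_sqr (x : R) : gauss_prim x ^ 2 + gauss_companion x = PI / 4.
Proof.
  destruct (mean_value (fun x => gauss_prim x ^ 2 + gauss_companion x) (fun _ => 0) 0 x)
    as [c [_ E]].
  - intros y _. evar_last.
    apply (is_derive_plus (fun x => gauss_prim x ^ 2) gauss_companion).
    apply (is_derive_pow gauss_prim 2). apply is_derive_gauss_prim.
    apply is_derive_gauss_companion.
    unfold plus; simpl. ring.
  - cbv beta in E. rewrite gauss_prim_0, gauss_companion_0 in E. lra.
Qed.

Lemma gauss_prim_nonneg (x : R) : 0 <= x -> 0 <= gauss_prim x.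
Proof.
  intros Hx. apply RInt_ge_0. assumption. apply ex_RInt_gauss. intros; left; apply exp_pos.
Qed.

Lemma gauss_prim_lim (u : nat -> R) :
  is_lim_seq u p_infty -> is_lim_seq (fun n => gauss_prim (u n)) (sqrt PI / 2).
Proof.
  intros Hu.
  assert (Hg : is_lim_seq (fun n => gauss (u n)) 0).
  { apply is_lim_seq_spec. intros eps.
    apply is_lim_seq_spec in Hu. destruct (Hu (Rmax 1 (- ln eps))) as [N HN].
    exists N. intros n Hn. specialize (HN n Hn).
    rewrite Rminus_0_r, Rabs_pos_eq by (left; apply exp_pos).
    unfold gauss. rewrite <- (exp_ln eps) by apply cond_pos. apply exp_increasing.
    generalize (Rmax_l 1 (- ln eps)) (Rmax_r 1 (- ln eps)). nra. }
  assert (Hc : is_lim_seq (fun n => gauss_companion (u n)) 0).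
  { apply is_lim_seq_le_le with (fun _ => 0) (fun n => gauss (u n)).
    intros; apply gauss_companion_bound. apply is_lim_seq_const. assumption. }
  assert (Hs : is_lim_seq (fun n => sqrt (PI / 4 - gauss_companion (u n))) (sqrt (PI / 4))).
  { apply (is_lim_seq_continuous sqrt (fun n => PI / 4 - gauss_companion (u n)) (PI / 4)).
    - apply continuity_pt_sqrt. generalize PI_RGT_0; lra.
    - evar_last. apply is_lim_seq_minus'. apply is_lim_seq_const. exact Hc.
      f_equal; ring. }
  replace (sqrt PI / 2) with (sqrt (PI / 4)).
  - apply is_lim_seq_ext_loc with (2 := Hs).
    apply is_lim_seq_spec in Hu. destruct (Hu 0) as [N HN].
    exists N. intros n Hn. specialize (HN n Hn).
    rewrite <- (gauss_prim_sqr (u n)).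
    replace (gauss_prim (u n) ^ 2 + gauss_companion (u n) - gauss_companion (u n))
      with (gauss_prim (u n) ^ 2) by ring.
    apply sqrt_pow2, gauss_prim_nonneg. lra.
  - rewrite sqrt_div_alt by lra. f_equal.
    replace 4 with (2 ^ 2) by ring. apply sqrt_pow2. lra.
Qed.

Lemma is_derive_gauss (x : R) : is_derive gauss x (- 2 * x * gauss x).
Proof. unfold gauss. auto_derive. exact I. simpl. ring. Qed.

Lemma is_derive_gauss' (x : R) :
  is_derive (fun x => - 2 * x * gauss x) x ((4 * x ^ 2 - 2) * gauss x).
Proof. unfold gauss. auto_derive. exact I. simpl. ring. Qed.

Lemma gauss''_bound (x : R) : Rabs ((4 * x ^ 2 - 2) * gauss x) <= 6.
Proof.
  assert (H1 : gauss x * exp (x ^ 2) = 1).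
  { unfold gauss. rewrite <- exp_plus, Rplus_opp_l. apply exp_0. }
  assert (H2 : 1 + x ^ 2 <= exp (x ^ 2)) by apply exp_ineq1_le.
  assert (H3 : 0 < gauss x) by apply exp_pos.
  assert (H4 : 0 <= x ^ 2) by apply pow2_ge_0.
  assert (H5 : gauss x * (1 + x ^ 2) <= 1) by nra.
  apply Rabs_le. nra.
Qed.

Lemma gauss_second_difference (x s : R) :
  0 <= s -> - (12 * s ^ 2) <= gauss (x + s) + gauss (x - s) - 2 * gauss x <= 12 * s ^ 2.
Proof.
  intros Hs.
  destruct (mean_value gauss (fun x => - 2 * x * gauss x) x (x + s)) as [c [Hc Ec]].
  { intros; apply is_derive_gauss. }
  destruct (mean_value gauss (fun x => - 2 * x * gauss x) (x - s) x) as [d [Hd Ed]].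
  { intros; apply is_derive_gauss. }
  rewrite Rmin_left, Rmax_right in Hc, Hd by lra.
  assert (H := increment_bound (fun x => - 2 * x * gauss x) _ d c 6
    (fun y _ => is_derive_gauss' y) (fun y _ => gauss''_bound y)).
  cbv beta in H.
  set (p := - 2 * c * gauss c) in *. set (q := - 2 * d * gauss d) in *.
  rewrite (Rabs_pos_eq (c - d)) in H by lra.
  apply Rabs_le_between in H.
  replace (gauss (x + s) + gauss (x - s) - 2 * gauss x) with ((p - q) * s) by lra.
  assert (6 * (c - d) <= 12 * s) by lra. nra.
Qed.

(** A first-order Riemann sum estimate would not do: with [h] of order
    [1 / sqrt r] and [r] cells, only an error [O (h ^ 3)] per cell adds up to
    something that vanishes. *)
Lemma gauss_midpoint_sum (h a : R) (N : nat) :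
  0 <= h ->
  Rabs (h * sum_n (fun m => gauss (h * (INR m + 1 / 2 - a))) N
        - (gauss_prim (h * (INR (S N) - a)) - gauss_prim (- (h * a))))
  <= INR (S N) * (3 / 2 * h ^ 3).
Proof.
  intros Hh.
  assert (Hcell : forall m,
    Rabs (h * gauss (h * (INR m + 1 / 2 - a))
      - (gauss_prim (h * (INR (S m) - a)) - gauss_prim (h * (INR m - a)))) <= 3 / 2 * h ^ 3).
  { intros m.
    destruct (midpoint_rule_error gauss_prim gauss (h * (INR m + 1 / 2 - a)) (h / 2)
                (- (3 * h ^ 2)) (3 * h ^ 2)) as [H1 H2].
    - lra.
    - intros; apply is_derive_gauss_prim.
    - intros s Hs. destruct (gauss_second_difference (h * (INR m + 1 / 2 - a)) s); [lra |].
      nra.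
    - rewrite S_INR.
      replace (h * (INR m + 1 / 2 - a) + h / 2) with (h * (INR m + 1 - a)) in * by lra.
      replace (h * (INR m + 1 / 2 - a) - h / 2) with (h * (INR m - a)) in * by lra.
      apply Rabs_le. simpl in *. nra. }
  induction N as [| N IH].
  - rewrite sum_O. specialize (Hcell 0%nat). simpl INR in *.
    rewrite Rmult_1_l. replace (- (h * a)) with (h * (0 - a)) by ring. exact Hcell.
  - rewrite sum_n_step. specialize (Hcell (S N)).
    rewrite (S_INR (S N)) in *.
    apply Rabs_le_between in IH. apply Rabs_le_between in Hcell. apply Rabs_le.
    set (e := 3 / 2 * h ^ 3) in *.
    rewrite Rmult_plus_distr_l.
    lra.
Qed.

(** After scaling by [h = sqrt (k / r)] the summation range becomes an interval
    from [- c sqrt (k r)] to [(1 - c) sqrt (k r)], which exhausts the line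
    because the peak [c r] stays inside the range, away from its ends. *)
Lemma gauss_sum_lim (k c : R) :
  0 < k -> 0 < c < 1 ->
  is_lim_seq (fun r =>
    sum_n (fun m => exp (- k * (INR m + 1 / 2 - c * INR r) ^ 2 / INR r)) (r - 1)
      / sqrt (INR r))
    (sqrt (PI / k)).
Proof.
  intros Hk Hc.
  set (q r := sqrt (INR r)).
  set (p := sqrt k).
  assert (Hp : 0 < p) by now apply sqrt_lt_R0.
  assert (Hp2 : p * p = k) by (apply sqrt_sqrt; lra).
  assert (Hmain : is_lim_seq (fun r =>
     (gauss_prim (p * (1 - c) * q r) + gauss_prim (p * c * q r)) / p) (sqrt (PI / k))).
  { replace (sqrt (PI / k)) with ((sqrt PI / 2 + sqrt PI / 2) / p).
    - apply is_lim_seq_div'; [| apply is_lim_seq_const | lra].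
      apply is_lim_seq_plus'.
      + apply gauss_prim_lim.
        replace p_infty with (Rbar_mult (p * (1 - c)) p_infty).
        apply is_lim_seq_scal_l, is_lim_seq_sqrt_INR.
        apply is_Rbar_mult_unique. apply is_Rbar_mult_sym, is_Rbar_mult_p_infty_pos. simpl. nra.
      + apply gauss_prim_lim.
        replace p_infty with (Rbar_mult (p * c) p_infty).
        apply is_lim_seq_scal_l, is_lim_seq_sqrt_INR.
        apply is_Rbar_mult_unique. apply is_Rbar_mult_sym, is_Rbar_mult_p_infty_pos. simpl. nra.
    - rewrite sqrt_div_alt by assumption. fold p. field. lra. }
  assert (Hb : forall r, (1 <= r)%nat ->
    Rabs (sum_n (fun m => exp (- k * (INR m + 1 / 2 - c * INR r) ^ 2 / INR r)) (r - 1) / q r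
     - (gauss_prim (p * (1 - c) * q r) + gauss_prim (p * c * q r)) / p) <= 3 / 2 * k * / q r).
  { intros r Hr. destruct r as [| N]; [lia |].
    replace (S N - 1)%nat with N by lia.
    assert (Hr0 : 0 < INR (S N)) by (apply lt_0_INR; lia).
    assert (Hq : 0 < q (S N)) by now apply sqrt_lt_R0.
    assert (Hq2 : q (S N) * q (S N) = INR (S N)) by (apply sqrt_sqrt; lra).
    set (Q := q (S N)) in *.
    set (h := p / Q).
    assert (Hh : 0 < h) by now apply Rdiv_lt_0_compat.
    generalize (gauss_midpoint_sum h (c * INR (S N)) N (Rlt_le _ _ Hh)).
    rewrite (sum_n_ext (fun m => gauss (h * (INR m + 1 / 2 - c * INR (S N))))
       (fun m => exp (- k * (INR m + 1 / 2 - c * INR (S N)) ^ 2 / INR (S N)))).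
    2:{ intros m. unfold gauss. f_equal. rewrite <- Hp2, <- Hq2. unfold h. field. lra. }
    set (s := sum_n _ N).
    replace (h * (INR (S N) - c * INR (S N))) with (p * (1 - c) * Q)
      by (rewrite <- Hq2; unfold h; field; lra).
    replace (- (h * (c * INR (S N)))) with (- (p * c * Q))
      by (rewrite <- Hq2; unfold h; field; lra).
    rewrite gauss_prim_opp.
    intros H.
    replace (s / Q - (gauss_prim (p * (1 - c) * Q) + gauss_prim (p * c * Q)) / p)
      with ((h * s - (gauss_prim (p * (1 - c) * Q) - - gauss_prim (p * c * Q))) * / p)
      by (unfold h; field; lra).
    rewrite Rabs_mult, (Rabs_pos_eq (/ p)) by (left; now apply Rinv_0_lt_compat).
    apply Rmult_le_reg_r with p. assumption.
    rewrite Rmult_assoc, Rinv_l, Rmult_1_r by lra.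
    apply Rle_trans with (1 := H). right.
    rewrite <- Hp2, <- Hq2. unfold h. field. lra. }
  apply is_lim_seq_ext_loc with (fun r =>
    (sum_n (fun m => exp (- k * (INR m + 1 / 2 - c * INR r) ^ 2 / INR r)) (r - 1) / q r
     - (gauss_prim (p * (1 - c) * q r) + gauss_prim (p * c * q r)) / p)
    + (gauss_prim (p * (1 - c) * q r) + gauss_prim (p * c * q r)) / p).
  { exists 0%nat. intros r _. unfold q. ring. }
  rewrite <- (Rplus_0_l (sqrt (PI / k))).
  apply is_lim_seq_plus'; [| exact Hmain].
  apply is_lim_seq_abs_0.
  apply is_lim_seq_le_le_loc with (fun _ => 0) (fun r => 3 / 2 * k * / q r).
  - exists 1%nat. intros r Hr. split. apply Rabs_pos. now apply Hb.
  - apply is_lim_seq_const.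
  - replace (Finite 0) with (Rbar_mult (3 / 2 * k) 0) by (simpl; f_equal; ring).
    apply is_lim_seq_scal_l, inv_sqrt_INR_lim.
Qed.

(** * The derivative of the Clausen function *)

(** The partial sums of the logarithmic series, evaluated on the unit interval,
    differ from [- ln (1 + x)] by a function whose derivative is at most
    [x ^ (N + 1)] in absolute value; the primitive of that bound is the
    remainder. *)
Lemma alternating_harmonic_remainder (N : nat) :
  Rabs (sum_n (fun k => (- 1) ^ S k / INR (S k)) N + ln 2) <= / INR (S (S N)).
Proof.
  set (g x := sum_n (fun k => (- x) ^ S k / INR (S k)) N + ln (1 + x)).
  set (dg x := (- x) ^ S N / (1 + x)).
  assert (Hg : forall x, 0 <= x <= 1 -> is_derive g x (dg x)).
  { intros x Hx. unfold g, dg. evar_last.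
    apply (is_derive_plus (fun x => sum_n (fun k => (- x) ^ S k / INR (S k)) N) (fun x => ln (1 + x))).
    - apply (is_derive_sum_n (fun k x => (- x) ^ S k / INR (S k)) N x (fun k => - (- x) ^ k)).
      intros k _. assert (INR (S k) <> 0) by (apply not_0_INR; lia).
      auto_derive. exact I.
      change (match k with O => 1 | S _ => INR k + 1 end) with (INR (S k)).
      simpl pred. field. assumption.
    - auto_derive. lra. reflexivity.
    - change (plus ?a ?b) with (a + b).
      assert (Hs : forall n, sum_n (fun k => - (- x) ^ k) n * (1 + x) = (- x) ^ S n - 1).
      { induction n as [| n IH].
        - rewrite sum_O. simpl. ring.
        - rewrite sum_n_step, Rmult_plus_distr_r, IH. simpl. ring. }
      apply Rmult_eq_reg_r with (1 + x); [| lra].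
      rewrite Rmult_plus_distr_r, Hs. field. lra. }
  assert (Hp : forall x, is_derive (fun x => x ^ S (S N) / INR (S (S N))) x (x ^ S N)).
  { generalize (S N). intros n x. assert (INR (S n) <> 0) by (apply not_0_INR; lia).
    auto_derive. exact I.
    change (match n with O => 1 | S _ => INR n + 1 end) with (INR (S n)).
    simpl pred. field. assumption. }
  assert (Hb : forall x, 0 <= x <= 1 -> - x ^ S N <= dg x <= x ^ S N).
  { intros x Hx. apply Rabs_le_between. unfold dg, Rdiv.
    rewrite Rabs_mult, <- RPow_abs, Rabs_Ropp, (Rabs_pos_eq x) by lra.
    rewrite <- (Rmult_1_r (x ^ S N)) at 2. apply Rmult_le_compat_l.
    apply pow_le; lra. rewrite Rabs_pos_eq.
    rewrite <- Rinv_1. apply Rinv_le_contravar; lra.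
    left; apply Rinv_0_lt_compat; lra. }
  assert (E0 : g 0 = 0).
  { unfold g. rewrite Rplus_0_r, ln_1, Rplus_0_r.
    rewrite (sum_n_ext _ (fun _ => 0)).
    - rewrite sum_n_const. ring.
    - intros k. rewrite Ropp_0, pow_i by lia. apply Rmult_0_l. }
  assert (E1 : g 1 = sum_n (fun k => (- 1) ^ S k / INR (S k)) N + ln 2).
  { unfold g. now replace (1 + 1) with 2 by ring. }
  rewrite <- E1.
  destruct (mean_value (fun x => x ^ S (S N) / INR (S (S N)) + g x) (fun x => x ^ S N + dg x) 0 1)
    as [c [Hc Ec]].
  { rewrite Rmin_left, Rmax_right by lra. intros x Hx.
    apply (is_derive_plus (fun x => x ^ S (S N) / INR (S (S N))) g). apply Hp. now apply Hg. }
  destruct (mean_value (fun x => x ^ S (S N) / INR (S (S N)) - g x) (fun x => x ^ S N - dg x) 0 1)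
    as [d [Hd Ed]].
  { rewrite Rmin_left, Rmax_right by lra. intros x Hx.
    apply (is_derive_minus (fun x => x ^ S (S N) / INR (S (S N))) g). apply Hp. now apply Hg. }
  rewrite Rmin_left, Rmax_right in Hc, Hd by lra.
  rewrite pow_i, pow1, E0 in Ec, Ed by lia.
  generalize (Hb c Hc) (Hb d Hd). intros.
  assert (0 / INR (S (S N)) = 0) by apply Rmult_0_l.
  assert (1 / INR (S (S N)) = / INR (S (S N))) by apply Rmult_1_l.
  apply Rabs_le. lra.
Qed.

(** The error of the partial sums of the Fourier series of
    [- ln (2 sin (t / 2))]. *)
Definition cosine_defect (N : nat) (t : R) : R :=
  sum_n (fun k => cos (INR (S k) * t) / INR (S k)) N + ln (2 * sin (t / 2)).

Lemma sin_half_pos (t : R) : 0 < t < 2 * PI -> 0 < sin (t / 2).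
Proof. intros Ht. apply sin_gt_0; lra. Qed.

Lemma conjugate_dirichlet_kernel (t : R) (N : nat) :
  2 * sin (t / 2) * sum_n (fun k => sin (INR (S k) * t)) N
  = cos (t / 2) - cos ((INR N + 3 / 2) * t).
Proof.
  assert (H : forall k, 2 * sin (t / 2) * sin (INR (S k) * t)
            = cos ((INR k + 1 / 2) * t) - cos ((INR k + 3 / 2) * t)).
  { intros k. rewrite S_INR.
    replace ((INR k + 1 / 2) * t) with ((INR k + 1) * t - t / 2) by field.
    replace ((INR k + 3 / 2) * t) with ((INR k + 1) * t + t / 2) by field.
    rewrite cos_plus, cos_minus. ring. }
  induction N as [| N IH].
  - rewrite sum_O, H. simpl INR. f_equal; f_equal; field.
  - rewrite sum_n_step, Rmult_plus_distr_l, IH, H, S_INR.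
    replace (INR N + 1 + 1 / 2) with (INR N + 3 / 2) by field. ring.
Qed.

(** Differentiating the cosine sum gives minus a conjugate Dirichlet kernel,
    whose nonoscillating part [cos (t / 2) / (2 sin (t / 2))] cancels the
    derivative of the logarithm. *)
Lemma is_derive_cosine_defect (N : nat) (t : R) :
  0 < t < 2 * PI ->
  is_derive (cosine_defect N) t (cos ((INR N + 3 / 2) * t) / (2 * sin (t / 2))).
Proof.
  intros Ht. assert (Hs := sin_half_pos t Ht).
  unfold cosine_defect. evar_last.
  apply (is_derive_plus (fun t => sum_n (fun k => cos (INR (S k) * t) / INR (S k)) N)
           (fun t => ln (2 * sin (t / 2)))).
  - apply (is_derive_sum_n (fun k t => cos (INR (S k) * t) / INR (S k)) N t
             (fun k => - 1 * sin (INR (S k) * t))).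
    intros k _. assert (INR (S k) <> 0) by (apply not_0_INR; lia).
    auto_derive. exact I.
    change (match k with O => 1 | S _ => INR k + 1 end) with (INR (S k)).
    field. assumption.
  - auto_derive. unfold Rdiv in Hs. lra. reflexivity.
  - change (plus ?a ?b) with (a + b).
    match goal with |- ?a + _ = _ =>
      change a with (sum_n (fun k => - 1 * sin (INR (S k) * t)) N) end.
    replace (sum_n (fun k => - 1 * sin (INR (S k) * t)) N)
      with (- sum_n (fun k => sin (INR (S k) * t)) N).
    + apply Rmult_eq_reg_l with (2 * sin (t / 2)); [| lra].
      rewrite Rmult_plus_distr_l, Ropp_mult_distr_r_reverse, conjugate_dirichlet_kernel.
      unfold Rdiv. field. unfold Rdiv in Hs. lra.
    + symmetry. etransitivity. apply (sum_n_mult_l (K := R_Ring) (- 1)).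
      change (- 1 * sum_n (fun k => sin (INR (S k) * t)) N
              = - sum_n (fun k => sin (INR (S k) * t)) N). ring.
Qed.

Lemma sin_half_ge_between (t u : R) :
  0 < t < 2 * PI -> Rmin PI t <= u <= Rmax PI t -> sin (t / 2) <= sin (u / 2).
Proof.
  intros Ht Hu. destruct (Rle_dec t PI).
  - rewrite Rmin_right, Rmax_left in Hu by lra. apply sin_incr_1; lra.
  - rewrite Rmin_left, Rmax_right in Hu by lra. apply sin_decr_1; lra.
Qed.

(** The derivative of the defect oscillates with frequency [N + 3/2] but does
    not tend to 0, so it is integrated by parts from [PI] to [t]: subtracting
    [sin (a u) / (2 a sin (u / 2))] with [a = N + 3/2] leaves a derivative of
    size [O (1 / N)].  At [PI] the defect is the alternating harmonic
    remainder. *)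
Lemma cosine_defect_bound (N : nat) (t : R) :
  0 < t < 2 * PI ->
  Rabs (cosine_defect N t) <= (2 + PI) / (INR (S N) * sin (t / 2) ^ 2).
Proof.
  intros Ht. assert (Hs := sin_half_pos t Ht). set (s := sin (t / 2)) in *.
  assert (Hs1 : s <= 1) by apply SIN_bound.
  set (a := INR N + 3 / 2).
  assert (HN := pos_INR N).
  assert (Ha : 0 < a) by (unfold a; lra).
  assert (Hpi := PI_RGT_0).
  assert (Hrange : forall u, Rmin PI t <= u <= Rmax PI t -> 0 < u < 2 * PI).
  { intros u Hu. destruct (Rle_dec t PI).
    rewrite Rmin_right, Rmax_left in Hu by lra. lra.
    rewrite Rmin_left, Rmax_right in Hu by lra. lra. }
  assert (Hm := increment_bound
    (fun u => cosine_defect N u - sin (a * u) / (2 * a * sin (u / 2)))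
    (fun u => sin (a * u) * cos (u / 2) / (4 * a * sin (u / 2) ^ 2))
    PI t (/ (4 * a * s ^ 2))).
  assert (H1 : Rabs (cosine_defect N t - sin (a * t) / (2 * a * s)
     - (cosine_defect N PI - sin (a * PI) / (2 * a))) <= / (4 * a * s ^ 2) * PI).
  { eapply Rle_trans. 2: eapply Rle_trans. 2: apply Hm.
    - right. f_equal. f_equal. f_equal. f_equal. rewrite sin_PI2. ring.
    - intros u Hu. assert (Hu0 := sin_half_pos u (Hrange u Hu)).
      evar_last. apply (is_derive_minus (cosine_defect N) (fun u => sin (a * u) / (2 * a * sin (u / 2)))).
      apply is_derive_cosine_defect. now apply Hrange.
      auto_derive. unfold Rdiv in *. apply Rgt_not_eq. nra. reflexivity.
      change (minus ?a ?b) with (a - b). fold a. unfold Rdiv in *. field. lra.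
    - intros u Hu. assert (Hu0 := sin_half_pos u (Hrange u Hu)).
      assert (Hu1 := sin_half_ge_between t u Ht Hu). fold s in Hu1.
      unfold Rdiv. rewrite Rabs_mult, Rabs_mult.
      rewrite (Rabs_pos_eq (/ _)).
      + rewrite <- (Rmult_1_l (/ (4 * a * s ^ 2))).
        apply Rmult_le_compat.
        * apply Rmult_le_pos; apply Rabs_pos.
        * left; apply Rinv_0_lt_compat. unfold Rdiv in Hu0. apply Rmult_lt_0_compat. lra. now apply pow_lt.
        * rewrite <- (Rmult_1_l 1). apply Rmult_le_compat; try apply Rabs_pos.
          apply Rabs_le, SIN_bound. apply Rabs_le, COS_bound.
        * apply Rinv_le_contravar. apply Rmult_lt_0_compat. lra. now apply pow_lt.
          apply Rmult_le_compat_l. lra. apply pow_incr. unfold Rdiv in Hu1. lra.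
      + left; apply Rinv_0_lt_compat. unfold Rdiv in Hu0. apply Rmult_lt_0_compat. lra. now apply pow_lt.
    - apply Rmult_le_compat_l.
      left; apply Rinv_0_lt_compat. apply Rmult_lt_0_compat. lra. now apply pow_lt.
      apply Rabs_le. lra. }
  assert (H2 : Rabs (cosine_defect N PI) <= / INR (S (S N))).
  { unfold cosine_defect. rewrite sin_PI2, Rmult_1_r.
    rewrite (sum_n_ext _ (fun k => (- 1) ^ S k / INR (S k))).
    apply alternating_harmonic_remainder.
    intros k. f_equal. induction (S k) as [| n IH].
    - simpl. rewrite Rmult_0_l. apply cos_0.
    - rewrite S_INR, Rmult_plus_distr_r, Rmult_1_l, neg_cos, IH. simpl. ring. }
  rewrite !S_INR in *.
  assert (Hn : 0 < INR N + 1) by lra.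
  set (n := INR N + 1) in *.
  (* each of the four error terms is compared with [B = / ((N + 1) s ^ 2)] *)
  assert (Hinv : forall y z, 0 < y -> y <= z -> / z <= / y) by (intros; now apply Rinv_le_contravar).
  assert (Hs2 : 0 < s ^ 2 <= s) by (split; [now apply pow_lt | simpl; nra]).
  set (B := / (n * s ^ 2)).
  assert (H0 : 0 < n * s ^ 2) by nra.
  assert (B1 : / (n + 1) <= B) by (apply Hinv; nra).
  assert (B2 : / (4 * a * s ^ 2) <= B / 4).
  { unfold B, Rdiv. rewrite <- Rinv_mult. apply Hinv. lra. unfold a. fold n. unfold n. nra. }
  assert (B3 : / (2 * a * s) <= B / 2).
  { unfold B, Rdiv. rewrite <- Rinv_mult. apply Hinv. lra. unfold a, n in *. nra. }
  assert (B4 : / (2 * a) <= B / 2).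
  { unfold B, Rdiv. rewrite <- Rinv_mult. apply Hinv. lra. unfold a, n in *. nra. }
  assert (HB : 0 < B) by now apply Rinv_0_lt_compat.
  assert (T1 : - (B / 2) <= sin (a * t) / (2 * a * s) <= B / 2).
  { destruct (SIN_bound (a * t)). assert (0 < / (2 * a * s)) by (apply Rinv_0_lt_compat; nra).
    unfold Rdiv at 2. split; nra. }
  assert (T2 : - (B / 2) <= sin (a * PI) / (2 * a) <= B / 2).
  { destruct (SIN_bound (a * PI)). assert (0 < / (2 * a)) by (apply Rinv_0_lt_compat; nra).
    unfold Rdiv at 2. split; nra. }
  replace ((2 + PI) / (n * s ^ 2)) with ((2 + PI) * B) by reflexivity.
  apply Rabs_le_between in H1. apply Rabs_le_between in H2. apply Rabs_le.
  assert (/ (4 * a * s ^ 2) * PI <= B / 4 * PI) by (apply Rmult_le_compat_r; lra).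
  assert (0 < B * PI) by nra. lra.
Qed.

Definition log_kernel (t : R) : R := ln (2 * sin (t / 2)).

Lemma continuous_log_kernel (t : R) : 0 < t < 2 * PI -> continuous log_kernel t.
Proof.
  intros Ht. assert (Hs := sin_half_pos t Ht).
  apply (ex_derive_continuous log_kernel). unfold log_kernel. auto_derive.
  unfold Rdiv in Hs. lra.
Qed.

Lemma between_PI (t u : R) :
  0 < t < 2 * PI -> Rmin PI t <= u <= Rmax PI t -> 0 < u < 2 * PI.
Proof.
  intros Ht Hu. assert (Hpi := PI_RGT_0). destruct (Rle_dec t PI).
  - rewrite Rmin_right, Rmax_left in Hu by lra. lra.
  - rewrite Rmin_left, Rmax_right in Hu by lra. lra.
Qed.

Lemma ex_RInt_log_kernel (t : R) : 0 < t < 2 * PI -> ex_RInt log_kernel PI t.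
Proof.
  intros Ht. apply (ex_RInt_continuous (V := R_CompleteNormedModule)).
  intros u Hu. apply continuous_log_kernel. now apply between_PI with t.
Qed.

Lemma locally_interval (a b x : R) (P : R -> Prop) :
  a < x < b -> (forall y, a < y < b -> P y) -> locally x P.
Proof.
  intros Hx H. apply (locally_interval P x a b); simpl; try tauto.
  intros y Ha Hb. now apply H.
Qed.

Lemma is_derive_log_kernel_prim (t : R) :
  0 < t < 2 * PI -> is_derive (fun t => RInt log_kernel PI t) t (log_kernel t).
Proof.
  intros Ht. apply (is_derive_RInt log_kernel (fun t => RInt log_kernel PI t) PI t).
  - apply (locally_interval 0 (2 * PI)); [assumption |]. intros y Hy.
    apply (RInt_correct (V := R_CompleteNormedModule)). now apply ex_RInt_log_kernel.
  - now apply continuous_log_kernel.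
Qed.

Definition clausen_sum (N : nat) (t : R) : R :=
  sum_n (fun k => sin (INR (S k) * t) / INR (S k) ^ 2) N.

Lemma is_derive_clausen_sum (N : nat) (t : R) :
  is_derive (clausen_sum N) t (cosine_defect N t - log_kernel t).
Proof.
  unfold clausen_sum. evar_last.
  apply (is_derive_sum_n (fun k t => sin (INR (S k) * t) / INR (S k) ^ 2) N t
           (fun k => cos (INR (S k) * t) / INR (S k))).
  - intros k _. assert (INR (S k) <> 0) by (apply not_0_INR; lia).
    set (a := INR (S k)) in *. auto_derive. exact I. simpl. field. assumption.
  - unfold cosine_defect, log_kernel. unfold Rminus. rewrite Rplus_assoc, Rplus_opp_r, Rplus_0_r.
    reflexivity.
Qed.

(** All partial sums vanish at [PI], and their derivatives converge uniformly
    to [- log_kernel] between [PI] and [t]; the base point [PI] keeps the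
    integral away from the singularities at [0] and [2 PI]. *)
Lemma Cl2_eq_RInt (t : R) : 0 < t < 2 * PI -> Cl2 t = - RInt log_kernel PI t.
Proof.
  intros Ht. apply is_series_unique.
  assert (Hs := sin_half_pos t Ht). set (s := sin (t / 2)) in *.
  assert (Hpi := PI_RGT_0).
  change (is_lim_seq (fun N => clausen_sum N t) (- RInt log_kernel PI t)).
  set (B := (2 + PI) / s ^ 2 * Rabs (t - PI)).
  apply is_lim_seq_ext with
    (fun N => (clausen_sum N t + RInt log_kernel PI t) + - RInt log_kernel PI t).
  { intros N. ring. }
  replace (Finite (- RInt log_kernel PI t)) with (Finite (0 + - RInt log_kernel PI t))
    by (f_equal; ring).
  apply is_lim_seq_plus'; [| apply is_lim_seq_const].
  apply is_lim_seq_abs_0.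
  apply is_lim_seq_le_le with (fun _ => 0) (fun N => B * / INR (S N)).
  - intros N. split. apply Rabs_pos.
    assert (HN : 0 < INR (S N)) by (apply lt_0_INR; lia).
    assert (Hs2 : 0 < s ^ 2) by now apply pow_lt.
    assert (E := increment_bound (fun u => clausen_sum N u + RInt log_kernel PI u)
             (fun u => cosine_defect N u) PI t ((2 + PI) / (INR (S N) * s ^ 2))).
    assert (E0 : clausen_sum N PI + RInt log_kernel PI PI = 0).
    { rewrite RInt_point. unfold clausen_sum. rewrite (sum_n_ext _ (fun _ => 0)).
      - rewrite sum_n_const. change (INR (S N) * 0 + 0 = 0). ring.
      - intros k. replace (sin (INR (S k) * PI)) with 0. apply Rmult_0_l.
        symmetry. apply sin_eq_0_1. exists (Z.of_nat (S k)). now rewrite INR_IZR_INZ. }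
    cbv beta in E. rewrite E0, Rminus_0_r in E.
    replace (B * / INR (S N)) with ((2 + PI) / (INR (S N) * s ^ 2) * Rabs (t - PI))
      by (unfold B; field; lra).
    apply E.
    + intros u Hu. evar_last.
      apply (is_derive_plus (clausen_sum N) (fun u => RInt log_kernel PI u)).
      apply is_derive_clausen_sum. apply is_derive_log_kernel_prim. now apply between_PI with t.
      change (plus ?a ?b) with (a + b). ring.
    + intros u Hu.
      assert (Hu1 := sin_half_ge_between t u Ht Hu). fold s in Hu1.
      eapply Rle_trans. apply cosine_defect_bound. now apply between_PI with t.
      unfold Rdiv. apply Rmult_le_compat_l. lra. apply Rinv_le_contravar.
      * now apply Rmult_lt_0_compat.
      * apply Rmult_le_compat_l. lra. apply pow_incr. unfold Rdiv in Hu1. lra.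
  - apply is_lim_seq_const.
  - replace (Finite 0) with (Rbar_mult B 0) by (simpl; f_equal; ring).
    apply is_lim_seq_scal_l.
    apply (is_lim_seq_incr_1 (fun N => / INR N)), inv_INR_lim.
Qed.

Lemma is_derive_Cl2 (t : R) :
  0 < t < 2 * PI -> is_derive Cl2 t (- ln (2 * sin (t / 2))).
Proof.
  intros Ht. apply is_derive_ext_loc with (fun t => - RInt log_kernel PI t).
  - apply (locally_interval 0 (2 * PI)); [assumption |].
    intros y Hy. symmetry. now apply Cl2_eq_RInt.
  - apply (is_derive_opp (fun t => RInt log_kernel PI t)). now apply is_derive_log_kernel_prim.
Qed.

Lemma Cl2_reflect (t : R) : Cl2 (2 * PI - t) = - Cl2 t.
Proof.
  unfold Cl2. rewrite <- Series_opp. apply Series_ext. intros n.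
  replace (INR (S n) * (2 * PI - t)) with (- (INR (S n) * t) + 2 * INR (S n) * PI) by ring.
  rewrite sin_period, sin_neg. unfold Rdiv. ring.
Qed.

(** * The potential *)

Definition log_factor (x : R) : R := ln (2 * sin (PI * x)).
(** The primitive of [log_factor] that is odd about [1 / 2]; it governs the
    exponential growth rate of the sine products. *)
Definition potential (x : R) : R := - Cl2 (2 * PI * x) / (2 * PI).

Lemma sin_PI_pos (x : R) : 0 < x < 1 -> 0 < sin (PI * x).
Proof. intros Hx. assert (Hpi := PI_RGT_0). apply sin_gt_0; nra. Qed.

Lemma is_derive_potential (x : R) : 0 < x < 1 -> is_derive potential x (log_factor x).
Proof.
  intros Hx. assert (Hpi := PI_RGT_0).
  apply is_derive_ext with (fun x => - / (2 * PI) * Cl2 (2 * PI * x)).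
  { intros y. change (- / (2 * PI) * Cl2 (2 * PI * y) = potential y).
    unfold potential. field. lra. }
  unfold log_factor. evar_last.
  - apply is_derive_scal.
    apply (is_derive_comp Cl2 (fun x => 2 * PI * x)).
    apply is_derive_Cl2. nra.
    auto_derive. exact I. reflexivity.
  - unfold scal; simpl; unfold mult; simpl.
    replace (2 * PI * x / 2) with (PI * x) by field. field. lra.
Qed.

Lemma potential_reflect (x : R) : potential (1 - x) = - potential x.
Proof.
  assert (Hpi := PI_RGT_0). unfold potential.
  replace (2 * PI * (1 - x)) with (2 * PI - 2 * PI * x) by ring.
  rewrite Cl2_reflect. field. lra.
Qed.

(** Where the hyperbolic volume enters: the reflection moves [5 PI / 3] to the
    angle [PI / 3] of the regular ideal tetrahedron. *)
Lemma potential_max : 2 * potential (5 / 6) = Vol_fig8 / (2 * PI).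
Proof.
  assert (Hpi := PI_RGT_0). unfold potential, Vol_fig8.
  replace (2 * PI * (5 / 6)) with (2 * PI - PI / 3) by field.
  rewrite Cl2_reflect. field. lra.
Qed.

(** * Reduction to a sum of squared sine products *)

Definition sine_factor (r l : nat) : R := 2 * sin (PI * (INR l / INR r)).

Fixpoint sine_prod (r m : nat) : R :=
  match m with
  | O => 1
  | S k => sine_prod r k * sine_factor r (S k)
  end.

Lemma Ceq (x y : C) : fst x = fst y -> snd x = snd y -> x = y.
Proof. exact (injective_projections x y). Qed.

Lemma xi_pow (r k : nat) :
  (1 <= r)%nat ->
  (xi r ^ k)%C = (cos (2 * (PI * (INR k / INR r))), sin (2 * (PI * (INR k / INR r)))).
Proof.
  intros Hr. assert (Hr0 : INR r <> 0) by (apply not_0_INR; lia).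
  assert (E : xi r = (cos (2 * PI / INR r), sin (2 * PI / INR r))).
  { unfold xi.
    replace (RtoC 2 * RtoC PI * Ci / RtoC (INR r))%C with ((0, 2 * PI / INR r) : C).
    - unfold Cexp, Re, Im. simpl fst. simpl snd. rewrite exp_0.
      apply Ceq; simpl; ring.
    - apply Ceq; simpl; field; repeat split; nra. }
  induction k as [| k IH].
  - simpl. replace (2 * (PI * (0 / INR r))) with 0 by (field; assumption).
    now rewrite cos_0, sin_0.
  - rewrite Cpow_S, IH, E, S_INR.
    replace (2 * (PI * ((INR k + 1) / INR r)))
      with (2 * PI / INR r + 2 * (PI * (INR k / INR r))) by (field; assumption).
    rewrite cos_plus, sin_plus. apply Ceq; simpl; ring.
Qed.

Lemma xi_pow_order (r : nat) : (1 <= r)%nat -> (xi r ^ r)%C = 1%C.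
Proof.
  intros Hr. assert (Hr0 : INR r <> 0) by (apply not_0_INR; lia).
  rewrite xi_pow by assumption.
  replace (2 * (PI * (INR r / INR r))) with (2 * PI) by (field; assumption).
  now rewrite cos_2PI, sin_2PI.
Qed.

Lemma fold_right_Cmult_init (c : C) (l : list C) :
  fold_right Cmult c l = (fold_right Cmult 1%C l * c)%C.
Proof.
  induction l as [| a l IH]; simpl.
  - ring.
  - rewrite IH. ring.
Qed.

Lemma Cprod_step (m : nat) (f : nat -> C) : Cprod 1 (S m) f = (Cprod 1 m f * f (S m))%C.
Proof.
  unfold Cprod. replace (S (S m) - 1)%nat with (S m) by lia.
  replace (S m - 1)%nat with m by lia.
  rewrite seq_S, map_app, fold_right_app, fold_right_Cmult_init. simpl. ring.
Qed.

(** Since [xi r ^ r = 1], the product is [|1 - xi r ^ l| ^ 2]. *)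
Lemma conjugate_factors (r l : nat) :
  (1 <= r)%nat -> (l <= r)%nat ->
  ((1 - xi r ^ (r - l)) * (1 - xi r ^ (r + l)))%C = RtoC (sine_factor r l ^ 2).
Proof.
  intros Hr Hl. assert (Hr0 : INR r <> 0) by (apply not_0_INR; lia).
  rewrite !xi_pow, minus_INR, plus_INR by assumption.
  set (x := PI * (INR l / INR r)).
  replace (2 * (PI * ((INR r - INR l) / INR r))) with (- (2 * x) + 2 * INR 1 * PI)
    by (unfold x; simpl; field; assumption).
  replace (2 * (PI * ((INR r + INR l) / INR r))) with (2 * x + 2 * INR 1 * PI)
    by (unfold x; simpl; field; assumption).
  rewrite !cos_period, !sin_period, cos_neg, sin_neg.
  unfold sine_factor. fold x. rewrite cos_2a_sin, sin_2a.
  generalize (sin2_cos2 x). unfold Rsqr. intros Hsc.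
  assert (Hc : cos x * cos x = 1 - sin x * sin x) by lra.
  apply Ceq; simpl; [| ring].
  replace (_ - _) with
    (4 * (sin x * sin x) * (sin x * sin x) + 4 * (sin x * sin x) * (cos x * cos x)) by ring.
  rewrite Hc. ring.
Qed.

Lemma RtoC_sum_n (f : nat -> R) (n : nat) : RtoC (sum_n f n) = sum_n (fun k => RtoC (f k)) n.
Proof.
  induction n as [| n IH].
  - now rewrite !sum_O.
  - rewrite !sum_Sn, <- IH. exact (RtoC_plus _ _).
Qed.

Lemma colored_Jones_top (r : nat) :
  (1 <= r)%nat ->
  colored_Jones_fig8 r r = RtoC (sum_n (fun m => sine_prod r m ^ 2) (r - 1)).
Proof.
  intros Hr. unfold colored_Jones_fig8. rewrite RtoC_sum_n.
  apply sum_n_ext_loc. intros m Hm.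
  rewrite Nat.mul_comm, Cpow_mult_r, xi_pow_order, Cpow_1_l by assumption.
  replace (/ RtoC 1)%C with (RtoC 1) by (field; apply C1_nz). rewrite Cmult_1_l.
  assert (Hm' : (m <= r)%nat) by lia. clear Hm.
  induction m as [| m IH].
  - simpl. now rewrite Rmult_1_l, Rmult_1_l.
  - rewrite Cprod_step, IH, conjugate_factors, <- RtoC_mult by lia.
    simpl sine_prod. f_equal. ring.
Qed.

(** * The full sine product *)

(** Monic polynomial functions of degree [n], given by their Horner scheme;
    this is all that is needed to divide by [x - a]. *)
Fixpoint monic (n : nat) (f : C -> C) : Prop :=
  match n with
  | O => forall x, f x = 1%C
  | S k => exists g c, monic k g /\ forall x, f x = (x * g x + c)%C
  end.

Lemma monic_difference_quotient (n : nat) (f : C -> C) (a : C) :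
  monic (S n) f -> exists q, monic n q /\ forall x, (f x - f a = (x - a) * q x)%C.
Proof.
  revert f. induction n as [| n IH]; intros f (g & c & Hg & Hf).
  - exists (fun _ => 1%C). split. easy. intros x. rewrite !Hf, !Hg. ring.
  - destruct (IH g Hg) as (q & Hq & Eq).
    exists (fun x => x * q x + g a)%C. split.
    + exists q, (g a). now split.
    + intros x. rewrite !Hf.
      replace (x * g x + c - (a * g a + c))%C with (x * (g x - g a) + (x - a) * g a)%C by ring.
      rewrite Eq. ring.
Qed.

Lemma monic_root_product (xs : list C) (f : C -> C) :
  monic (length xs) f -> NoDup xs -> (forall x, In x xs -> f x = 0%C) ->
  forall z, f z = fold_right Cmult 1%C (map (fun x => z - x)%C xs).
Proof.
  revert f. induction xs as [| a xs IH]; intros f Hf Hnd Hroot z.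
  - apply Hf.
  - destruct (monic_difference_quotient _ f a Hf) as (q & Hq & Eq).
    rewrite (Hroot a) in Eq by now left.
    inversion_clear Hnd as [| ? ? Ha Hnd'].
    simpl. rewrite <- (IH q Hq Hnd'), <- Eq. ring.
    intros x Hx.
    assert (E := Eq x). rewrite (Hroot x) in E by now right.
    assert (Hxa : (x - a)%C <> 0%C).
    { intros E0. apply Ha. replace a with x; [assumption |].
      replace x with (x - a + a)%C by ring. rewrite E0. ring. }
    replace (q x) with (/ (x - a) * ((x - a) * q x))%C by (field; assumption).
    rewrite <- E. ring.
Qed.

Fixpoint geometric (n : nat) (x : C) : C :=
  match n with
  | O => 1%C
  | S k => (x * geometric k x + 1)%C
  end.

Lemma geometric_monic (n : nat) : monic n (geometric n).
Proof. induction n as [| n IH]; [easy |]. now exists (geometric n), 1%C. Qed.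

Lemma geometric_telescopes (n : nat) (x : C) :
  ((x - 1) * geometric n x = x ^ S n - 1)%C.
Proof.
  induction n as [| n IH].
  - simpl. ring.
  - rewrite Cpow_S. replace (x ^ S n)%C with ((x - 1) * geometric n x + 1)%C by (rewrite IH; ring).
    simpl. ring.
Qed.

Lemma geometric_1 (n : nat) : geometric n 1%C = RtoC (INR (S n)).
Proof.
  induction n as [| n IH].
  - reflexivity.
  - rewrite S_INR, RtoC_plus, <- IH. simpl. ring.
Qed.

Lemma sine_factor_pos (r l : nat) : (1 <= l < r)%nat -> 0 < sine_factor r l.
Proof.
  intros Hl. unfold sine_factor.
  assert (0 < INR l) by (apply lt_0_INR; lia).
  assert (INR l < INR r) by (apply lt_INR; lia).
  assert (0 < sin (PI * (INR l / INR r))); [| lra].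
  apply sin_PI_pos. split.
  - apply Rdiv_lt_0_compat; lra.
  - apply Rlt_div_l; lra.
Qed.

Lemma sine_prod_pos (r m : nat) : (m < r)%nat -> 0 < sine_prod r m.
Proof.
  induction m as [| m IH]; intros Hm; simpl. lra.
  apply Rmult_lt_0_compat. apply IH; lia. apply sine_factor_pos; lia.
Qed.

Lemma Cmod_one_minus_xi (r l : nat) :
  (1 <= l < r)%nat -> Cmod (1 - xi r ^ l)%C = sine_factor r l.
Proof.
  intros Hl. assert (Hpos := sine_factor_pos r l Hl).
  rewrite xi_pow by lia. unfold sine_factor in *. set (x := PI * (INR l / INR r)) in *.
  unfold Cmod. rewrite <- (sqrt_pow2 (2 * sin x)) by lra. f_equal.
  rewrite cos_2a_sin, sin_2a.
  generalize (sin2_cos2 x). unfold Rsqr. intros Hsc.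
  assert (Hc : cos x * cos x = 1 - sin x * sin x) by lra.
  simpl.
  replace (_ + _) with
    (4 * (sin x * sin x) * (sin x * sin x) + 4 * (sin x * sin x) * (cos x * cos x)) by ring.
  rewrite Hc. ring.
Qed.

Lemma xi_pow_neq_1 (r l : nat) : (1 <= l < r)%nat -> (xi r ^ l)%C <> 1%C.
Proof.
  intros Hl E. assert (H := Cmod_one_minus_xi r l Hl).
  rewrite E in H. replace (1 - 1)%C with (RtoC 0) in H by ring. rewrite Cmod_0 in H.
  generalize (sine_factor_pos r l Hl). lra.
Qed.

Lemma xi_pow_inj (r i j : nat) : (i < j < r)%nat -> (xi r ^ i)%C <> (xi r ^ j)%C.
Proof.
  intros Hij E.
  assert (Hnz : (xi r ^ i)%C <> 0%C).
  { apply Cpow_nz. intros E0. assert (H := xi_pow_order r ltac:(lia)).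
    rewrite E0 in H. destruct r; [lia |]. rewrite Cpow_S, Cmult_0_l in H.
    injection H. lra. }
  apply (xi_pow_neq_1 r (j - i)); [lia |].
  replace j with (i + (j - i))%nat in E by lia. rewrite Cpow_add_r in E.
  replace (xi r ^ (j - i))%C with (/ xi r ^ i * (xi r ^ i * xi r ^ (j - i)))%C
    by (field; assumption).
  rewrite <- E. now field.
Qed.

(** The nontrivial [r]-th roots of unity are the [r - 1] roots of
    [1 + x + ... + x ^ (r - 1)]; at [x = 1] the factorization reads
    [r = (1 - xi) ... (1 - xi ^ (r - 1))], and [|1 - xi ^ l|] is the sine
    factor. *)
Lemma sine_prod_full (r : nat) : (1 <= r)%nat -> sine_prod r (r - 1) = INR r.
Proof.
  intros Hr.
  set (xs := map (fun l => (xi r ^ l)%C) (seq 1 (r - 1))).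
  assert (E : geometric (r - 1) 1%C = fold_right Cmult 1%C (map (fun x => 1 - x)%C xs)).
  { apply monic_root_product.
    - unfold xs. rewrite length_map, length_seq. apply geometric_monic.
    - unfold xs. apply Injective_map_NoDup_in; [| apply seq_NoDup].
      intros i j Hi Hj Eij. apply in_seq in Hi. apply in_seq in Hj.
      destruct (Nat.lt_trichotomy i j) as [H | [H | H]]; [exfalso | assumption | exfalso].
      + apply (xi_pow_inj r i j); [lia | assumption].
      + apply (xi_pow_inj r j i); [lia | now symmetry].
    - intros x Hx. unfold xs in Hx. apply in_map_iff in Hx. destruct Hx as (l & <- & Hl).
      apply in_seq in Hl.
      assert (H1 := xi_pow_neq_1 r l ltac:(lia)).
      assert (H := geometric_telescopes (r - 1) (xi r ^ l)%C).
      replace (S (r - 1)) with r in H by lia.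
      rewrite <- Cpow_mult_r, Nat.mul_comm, Cpow_mult_r, xi_pow_order, Cpow_1_l in H by assumption.
      assert (Hn : (xi r ^ l - 1)%C <> 0%C).
      { intros E0. apply H1. replace (xi r ^ l)%C with (xi r ^ l - 1 + 1)%C by ring.
        rewrite E0. ring. }
      set (y := (xi r ^ l)%C) in *. set (q := geometric (r - 1) y) in *.
      replace q with (/ (y - 1) * ((y - 1) * q))%C by (field; assumption).
      rewrite H. ring. }
  rewrite geometric_1 in E. replace (S (r - 1)) with r in E by lia.
  apply (f_equal Cmod) in E.
  rewrite Cmod_R, Rabs_pos_eq in E by apply pos_INR.
  rewrite E. unfold xs. rewrite map_map.
  assert (Hm : (r - 1 < r)%nat) by lia. revert Hm. generalize (r - 1)%nat.
  clear xs E. induction n as [| n IH]; intros Hn.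
  - simpl. now rewrite Cmod_1.
  - rewrite seq_S, map_app, fold_right_app, fold_right_Cmult_init, Cmult_comm, Cmod_mult.
    simpl sine_prod. rewrite IH by lia. rewrite Rmult_comm. f_equal.
    rewrite <- Cmod_one_minus_xi by lia. simpl. now rewrite Cmult_1_r.
Qed.

Lemma sine_factor_reflect (r l : nat) :
  (1 <= r)%nat -> (l <= r)%nat -> sine_factor r (r - l) = sine_factor r l.
Proof.
  intros Hr Hl. assert (Hr0 : INR r <> 0) by (apply not_0_INR; lia).
  unfold sine_factor. rewrite minus_INR by assumption.
  replace (PI * ((INR r - INR l) / INR r)) with (PI - PI * (INR l / INR r))
    by (field; assumption).
  now rewrite sin_PI_x.
Qed.

(** The upper end of the full product is its lower end reflected, because
    [sin (PI - x) = sin x]. *)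
Lemma sine_prod_reflect (r m : nat) :
  (m < r)%nat -> sine_prod r m * sine_prod r (r - 1 - m) = INR r.
Proof.
  induction m as [| m IH]; intros Hm.
  - rewrite Nat.sub_0_r, sine_prod_full by lia. simpl. ring.
  - rewrite <- IH by lia.
    replace (r - 1 - m)%nat with (S (r - 1 - S m)) by lia.
    simpl sine_prod. replace (S (r - 1 - S m)) with (r - S m)%nat by lia.
    rewrite sine_factor_reflect by lia. ring.
Qed.

(** * Comparing sine products with the potential *)

Lemma sin_mul_sin_difference (a b : R) :
  sin (a + b) * sin (a - b) = sin a ^ 2 - sin b ^ 2.
Proof.
  rewrite sin_plus, sin_minus.
  assert (Ha := sin2_cos2 a). assert (Hb := sin2_cos2 b). unfold Rsqr in *.
  replace (_ * _) with (sin a * sin a * (cos b * cos b) - cos a * cos a * (sin b * sin b)) by ring.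
  replace (cos b * cos b) with (1 - sin b * sin b) by lra.
  replace (cos a * cos a) with (1 - sin a * sin a) by lra. ring.
Qed.

Lemma sin_sqr_le (a : R) : sin a ^ 2 <= a ^ 2.
Proof.
  rewrite <- (pow2_abs (sin a)), <- (pow2_abs a). apply pow_incr. split. apply Rabs_pos.
  assert (H := increment_bound sin cos 0 a 1).
  rewrite sin_0, !Rminus_0_r, Rmult_1_l in H. apply H.
  - intros x _. apply is_derive_sin.
  - intros x _. apply Rabs_le, COS_bound.
Qed.

Lemma exp_neg_double_le (t : R) : 0 <= t <= 1 / 2 -> exp (- (2 * t)) <= 1 - t.
Proof.
  intros Ht. assert (H := exp_ineq1_le (2 * t)).
  assert (Hp := exp_pos (- (2 * t))).
  assert (E : exp (- (2 * t)) * exp (2 * t) = 1) by (rewrite <- exp_plus, Rplus_opp_l; apply exp_0).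
  assert (H1 : exp (- (2 * t)) * (1 + 2 * t) <= 1) by nra.
  nra.
Qed.

(** By [sin_mul_sin_difference] the second difference is
    [ln (1 - sin (PI s) ^ 2 / sin (PI x) ^ 2)], which is nonpositive and of
    order [s ^ 2] as long as [sin (PI x)] is bounded below. *)
Lemma log_factor_second_difference (x s s0 : R) :
  0 < x - s -> x + s < 1 -> 0 < s0 <= sin (PI * x) -> 0 <= s ->
  2 * (PI * s) ^ 2 <= s0 ^ 2 ->
  - (2 * ((PI * s) ^ 2 / s0 ^ 2)) <= log_factor (x + s) + log_factor (x - s) - 2 * log_factor x <= 0.
Proof.
  intros Hl Hr Hs0 Hs Hsmall.
  assert (Ha : 0 < sin (PI * (x + s))) by (apply sin_PI_pos; lra).
  assert (Hb : 0 < sin (PI * (x - s))) by (apply sin_PI_pos; lra).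
  assert (Eab : sin (PI * (x + s)) * sin (PI * (x - s)) = sin (PI * x) ^ 2 - sin (PI * s) ^ 2).
  { rewrite Rmult_plus_distr_l, Rmult_minus_distr_l. apply sin_mul_sin_difference. }
  assert (Hsin := sin_sqr_le (PI * s)).
  unfold log_factor.
  set (a := sin (PI * (x + s))) in *. set (b := sin (PI * (x - s))) in *.
  set (c := sin (PI * x)) in *. set (d := sin (PI * s)) in *.
  assert (Hd : 0 <= d ^ 2) by apply pow2_ge_0.
  assert (Hs02 : 0 < s0 ^ 2) by (apply pow_lt; lra).
  assert (Hc2 : s0 ^ 2 <= c ^ 2) by (apply pow_incr; lra).
  rewrite <- ln_mult by lra.
  replace (2 * ln (2 * c)) with (ln ((2 * c) * (2 * c))) by (rewrite ln_mult; lra).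
  set (t := (PI * s) ^ 2 / s0 ^ 2).
  assert (Ht : 0 <= t <= 1 / 2).
  { unfold t. split.
    - apply Rdiv_le_0_compat. apply pow2_ge_0. assumption.
    - apply Rle_div_l; lra. }
  assert (Et : t * s0 ^ 2 = (PI * s) ^ 2) by (unfold t; field; lra).
  split.
  - rewrite <- (ln_exp (- (2 * t))).
    assert (ln (exp (- (2 * t)) * (2 * c * (2 * c))) <= ln (2 * a * (2 * b))).
    { apply ln_le.
      - apply Rmult_lt_0_compat. apply exp_pos. nra.
      - assert (H := exp_neg_double_le t Ht).
        apply Rle_trans with ((1 - t) * (2 * c * (2 * c))).
        + apply Rmult_le_compat_r; nra.
        + replace (2 * a * (2 * b)) with (4 * (a * b)) by ring. rewrite Eab.
          assert (t * s0 ^ 2 <= t * c ^ 2) by (apply Rmult_le_compat_l; lra). nra. }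
    rewrite ln_mult in H; [lra | apply exp_pos | nra].
  - assert (ln (2 * a * (2 * b)) <= ln (2 * c * (2 * c))); [| lra].
    apply ln_le; nra.
Qed.

Lemma sin_PI_lower_bound (x : R) : 1 / 12 <= x <= 11 / 12 -> sin (PI * (1 / 12)) <= sin (PI * x).
Proof.
  intros Hx. assert (Hpi := PI_RGT_0).
  destruct (Rle_dec x (1 / 2)).
  - apply sin_incr_1; nra.
  - rewrite <- (sin_PI_x (PI * x)). apply sin_incr_1; nra.
Qed.

(** The end point between the cells of width [1 / r] centered at [m / r] and
    [(m + 1) / r]. *)
Definition midpoint (r m : nat) : R := (INR m + 1 / 2) / INR r.

Definition potential_defect (r m : nat) : R :=
  ln (sine_prod r m) - INR r * potential (midpoint r m).

(** One step of the product adds [log_factor x] with [x = (m + 1) / r], and the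
    potential term changes by [r] times its increment over the cell centered at
    [x]: this is the midpoint rule on a single cell.  The interval allowed for
    [x] contains [5 / 6] in its interior, is symmetric about [1 / 2] so that it
    serves [m] and [r - 1 - m] alike, and stays away from the singularities at
    [0] and [1]. *)
Lemma potential_defect_step :
  exists C R0, 0 <= C /\ forall r m : nat,
    R0 <= INR r -> (m < r)%nat -> 1 / 12 <= INR (S m) / INR r <= 11 / 12 ->
    0 <= potential_defect r (S m) - potential_defect r m <= C / INR r ^ 2.
Proof.
  set (s0 := sin (PI * (1 / 12))).
  assert (Hpi := PI_RGT_0).
  assert (Hs0 : 0 < s0) by (apply sin_PI_pos; lra).
  exists (PI ^ 2 / (4 * s0 ^ 2)), (Rmax 12 (PI / s0)). split.
  { apply Rdiv_le_0_compat. apply pow2_ge_0. apply Rmult_lt_0_compat. lra. now apply pow_lt. }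
  intros r m HR Hm Hx.
  assert (HR1 : 12 <= INR r) by (eapply Rle_trans; [apply Rmax_l | exact HR]).
  assert (HR2 : PI / s0 <= INR r) by (eapply Rle_trans; [apply Rmax_r | exact HR]).
  set (n := INR r) in *. set (x := INR (S m) / n) in *. set (h := / (2 * n)).
  assert (Hh : 0 < h) by (apply Rinv_0_lt_compat; lra).
  assert (Hh2 : 2 * h * n = 1) by (unfold h; field; lra).
  assert (Hph : PI * h <= s0 / 2).
  { unfold h. apply Rle_div_l in HR2; [| assumption].
    apply Rmult_le_reg_r with (2 * n). lra. rewrite Rmult_assoc, Rinv_l by lra. lra. }
  assert (Hh12 : h <= 1 / 24).
  { unfold h. rewrite <- (Rinv_inv (1 / 24)). apply Rinv_le_contravar. lra.
    replace (/ (1 / 24)) with 24 by field. lra. }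
  assert (Hsx : s0 <= sin (PI * x)) by (apply sin_PI_lower_bound; lra).
  assert (HsB : forall s, 0 <= s <= h -> 2 * (PI * s) ^ 2 <= s0 ^ 2).
  { intros s Hs. assert (0 <= PI * s <= s0 / 2) by nra. nra. }
  destruct (midpoint_rule_error potential log_factor x h
     (- (2 * ((PI * h) ^ 2 / s0 ^ 2))) 0) as [H1 H2].
  - lra.
  - intros y Hy. apply is_derive_potential. lra.
  - intros s Hs.
    destruct (log_factor_second_difference x s s0) as [G1 G2]; try lra.
    now apply HsB.
    split; [| assumption]. eapply Rle_trans; [| exact G1].
    apply Ropp_le_contravar. apply Rmult_le_compat_l. lra.
    unfold Rdiv. apply Rmult_le_compat_r.
    left; apply Rinv_0_lt_compat; now apply pow_lt.
    apply pow_incr. nra.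
  - unfold potential_defect. simpl sine_prod.
    assert (Hsp := sine_prod_pos r m Hm).
    assert (Hf : 0 < sine_factor r (S m)).
    { unfold sine_factor. fold n. fold x. lra. }
    rewrite ln_mult by assumption.
    replace (ln (sine_factor r (S m))) with (log_factor x) by reflexivity.
    replace (midpoint r (S m)) with (x + h)
      by (unfold midpoint, x, h; fold n; field; lra).
    replace (midpoint r m) with (x - h)
      by (unfold midpoint, x, h; rewrite S_INR; fold n; field; lra).
    fold n.
    set (D := potential (x + h) - potential (x - h)) in *.
    replace (_ - _) with (log_factor x - n * D) by (unfold D; ring).
    replace (log_factor x) with (n * (2 * h * log_factor x))
      by (transitivity (2 * h * n * log_factor x); [ring | rewrite Hh2; ring]).
    split.
    + nra.
    + replace (PI ^ 2 / (4 * s0 ^ 2) / n ^ 2) with (n * (2 * ((PI * h) ^ 2 / s0 ^ 2) * h))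
        by (unfold h; field; lra).
      rewrite <- Rmult_minus_distr_l. apply Rmult_le_compat_l; lra.
Qed.

(** The reflection formulas for the sine product and for the potential fix the
    sum of the defects at [m] and [r - 1 - m] to be exactly [ln r], while their
    difference is a sum of at most [r] single steps, hence [O (1 / r)].  So the
    defect at [m] is known without any information on what happens near the
    singular end [0]. *)
Lemma sine_prod_sqr_estimate :
  exists C R0, 0 <= C /\ forall r m : nat,
    R0 <= INR r -> 1 / 2 <= midpoint r m -> INR m / INR r <= 11 / 12 ->
    INR r * exp (2 * INR r * potential (midpoint r m)) <= sine_prod r m ^ 2
    <= INR r * exp (2 * INR r * potential (midpoint r m)) * exp (C / INR r).
Proof.
  destruct potential_defect_step as (C & R0 & HC & Hstep).
  exists C, (Rmax 1 R0). split; [assumption |].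
  intros r m HR Hy Hm.
  assert (HR1 : 1 <= INR r) by (eapply Rle_trans; [apply Rmax_l | exact HR]).
  assert (HR2 : R0 <= INR r) by (eapply Rle_trans; [apply Rmax_r | exact HR]).
  set (n := INR r) in *.
  assert (Hmr : (m < r)%nat).
  { apply INR_lt. fold n. apply (Rle_div_l _ _ n) in Hm; lra. }
  assert (Hm2 : (r - 1 - m <= m)%nat).
  { apply INR_le. rewrite !minus_INR by lia. fold n. simpl.
    unfold midpoint in Hy. fold n in Hy. apply (Rle_div_r _ _ n) in Hy; lra. }
  set (m' := (r - 1 - m)%nat) in *.
  assert (Em' : INR m' = n - 1 - INR m).
  { unfold m'. rewrite !minus_INR by lia. reflexivity. }
  assert (Hsum : forall j, (m' + j <= m)%nat ->
    0 <= potential_defect r (m' + j) - potential_defect r m' <= INR j * (C / n ^ 2)).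
  { induction j as [| j IH]; intros Hj.
    - rewrite Nat.add_0_r. simpl. lra.
    - assert (H1 := IH ltac:(lia)).
      assert (H2 : 0 <= potential_defect r (S (m' + j)) - potential_defect r (m' + j) <= C / n ^ 2).
      { apply Hstep. assumption. lia. fold n.
        apply (Rle_div_l _ _ n) in Hm; [| lra].
        assert (INR (S (m' + j)) <= INR m) by (apply le_INR; lia).
        rewrite S_INR, plus_INR, Em' in *. assert (0 <= INR j) by apply pos_INR.
        split; [apply (Rle_div_r _ _ n) | apply (Rle_div_l _ _ n)]; lra. }
      rewrite Nat.add_succ_r, S_INR. lra. }
  specialize (Hsum (m - m')%nat ltac:(lia)).
  replace (m' + (m - m'))%nat with m in Hsum by lia.
  assert (Hj : INR (m - m') * (C / n ^ 2) <= C / n).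
  { replace (C / n) with (n * (C / n ^ 2)) by (field; lra).
    apply Rmult_le_compat_r. apply Rdiv_le_0_compat. assumption. apply pow_lt; lra.
    apply le_INR. lia. }
  assert (Hrefl : potential_defect r m + potential_defect r m' = ln n).
  { unfold potential_defect.
    replace (midpoint r m') with (1 - midpoint r m)
      by (unfold midpoint; rewrite Em'; fold n; field; lra).
    rewrite potential_reflect.
    unfold n. rewrite <- (sine_prod_reflect r m Hmr). fold m'.
    rewrite ln_mult by (apply sine_prod_pos; lia). ring. }
  assert (Hp := sine_prod_pos r m Hmr).
  set (p := potential (midpoint r m)) in *.
  assert (El : ln (sine_prod r m) = potential_defect r m + n * p).
  { unfold potential_defect. fold n. fold p. ring. }
  assert (Es : sine_prod r m ^ 2
    = n * exp (2 * n * p) * exp (potential_defect r m - potential_defect r m')).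
  { rewrite <- (exp_ln n) at 1 by lra. rewrite <- !exp_plus.
    rewrite <- (exp_ln (sine_prod r m)) by assumption.
    rewrite <- Rsqr_pow2. unfold Rsqr. rewrite <- exp_plus, El. f_equal. lra. }
  rewrite Es.
  assert (Hpos : 0 < n * exp (2 * n * p)) by (apply Rmult_lt_0_compat; [lra | apply exp_pos]).
  split.
  - rewrite <- (Rmult_1_r (n * exp (2 * n * p))) at 1. apply Rmult_le_compat_l. lra.
    eapply Rle_trans; [| apply exp_ineq1_le]. lra.
  - apply Rmult_le_compat_l. lra.
    apply exp_monotone. lra.
Qed.

Lemma log_factor_max_point : log_factor (5 / 6) = 0.
Proof.
  unfold log_factor. replace (PI * (5 / 6)) with (PI - PI / 6) by field.
  rewrite sin_PI_x, sin_PI6. replace (2 * (1 / 2)) with 1 by field. apply ln_1.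
Qed.

Lemma is_derive_log_factor_max_point : is_derive log_factor (5 / 6) (- (PI * sqrt 3)).
Proof.
  assert (Hs : sin (PI * (5 / 6)) = 1 / 2).
  { replace (PI * (5 / 6)) with (PI - PI / 6) by field. now rewrite sin_PI_x, sin_PI6. }
  assert (Hc : cos (PI * (5 / 6)) = - (sqrt 3 / 2)).
  { replace (PI * (5 / 6)) with (- (PI / 6) + PI) by field.
    now rewrite neg_cos, cos_neg, cos_PI6. }
  unfold log_factor. auto_derive.
  - rewrite Hs. lra.
  - rewrite Hs, Hc. field.
Qed.

(** Only the derivative of [log_factor] at the point [5 / 6] is used: it
    bounds [log_factor] between two linear functions near that point, and the
    mean value theorem integrates the bounds. *)
Lemma potential_quadratic (k1 k2 : R) :
  k1 < PI * sqrt 3 < k2 ->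
  exists d, 0 < d < 1 / 24 /\ forall u, Rabs u <= d ->
    - k2 * u ^ 2 <= 2 * potential (5 / 6 + u) - 2 * potential (5 / 6) <= - k1 * u ^ 2.
Proof.
  intros Hk.
  assert (Hder := proj1 (is_derive_Reals _ _ _) is_derive_log_factor_max_point).
  set (k := PI * sqrt 3) in *.
  destruct (Hder (Rmin (k - k1) (k2 - k))) as [d Hd].
  { apply Rmin_glb_lt; lra. }
  assert (Hlin : forall v, Rabs v < d ->
    Rabs (log_factor (5 / 6 + v) + k * v) <= Rmin (k - k1) (k2 - k) * Rabs v).
  { intros v Hv. destruct (Req_dec v 0) as [-> | Hv0].
    - rewrite Rplus_0_r, log_factor_max_point, !Rmult_0_r, Rplus_0_r, Rabs_R0. lra.
    - specialize (Hd v Hv0 Hv). rewrite log_factor_max_point in Hd.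
      replace (log_factor (5 / 6 + v) + k * v)
        with (((log_factor (5 / 6 + v) - 0) / v - - k) * v) by (field; assumption).
      rewrite Rabs_mult. apply Rmult_le_compat_r. apply Rabs_pos. now left. }
  assert (Hd0 := cond_pos d).
  exists (Rmin (d / 2) (1 / 48)). split.
  { split. apply Rmin_glb_lt; lra. generalize (Rmin_r (d / 2) (1 / 48)). lra. }
  intros u Hu.
  assert (Hu1 : Rabs u <= d / 2) by (eapply Rle_trans; [exact Hu | apply Rmin_l]).
  assert (Hu2 : Rabs u <= 1 / 48) by (eapply Rle_trans; [exact Hu | apply Rmin_r]).
  apply Rabs_le_between in Hu1. apply Rabs_le_between in Hu2.
  assert (Hbetween : forall v, Rmin 0 u <= v <= Rmax 0 u ->
     -1/48 <= v <= 1/48 /\ Rabs v < d /\ 0 <= v * u).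
  { intros v Hv. destruct (Rle_dec 0 u).
    - rewrite Rmin_left, Rmax_right in Hv by lra.
      split; [lra |]. split; [apply Rabs_lt_between; lra | nra].
    - rewrite Rmin_right, Rmax_left in Hv by lra.
      split; [lra |]. split; [apply Rabs_lt_between; lra | nra]. }
  assert (Hquad : forall k', exists v, Rmin 0 u <= v <= Rmax 0 u /\
    2 * potential (5 / 6 + u) + k' * u ^ 2 - 2 * potential (5 / 6)
    = 2 * (log_factor (5 / 6 + v) + k' * v) * u).
  { intros k'.
    destruct (mean_value (fun v => 2 * potential (5 / 6 + v) + k' * v ^ 2)
      (fun v => 2 * (log_factor (5 / 6 + v) + k' * v)) 0 u) as [v [Hv Ev]].
    - intros v Hv. destruct (Hbetween v Hv) as [Hv1 _]. evar_last.
      + apply (is_derive_plus (fun v => 2 * potential (5 / 6 + v)) (fun v => k' * v ^ 2)).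
        * apply is_derive_scal. apply (is_derive_comp potential (fun v => 5 / 6 + v)).
          apply is_derive_potential. lra. auto_derive. exact I. reflexivity.
        * auto_derive. exact I. reflexivity.
      + unfold plus, scal; simpl; unfold mult; simpl. ring.
    - exists v. split; [assumption |]. cbv beta in Ev.
      rewrite Rplus_0_r in Ev. rewrite Rminus_0_r in Ev. rewrite <- Ev. ring. }
  assert (Hv : forall v, Rmin 0 u <= v <= Rmax 0 u ->
    - (Rmin (k - k1) (k2 - k) * (v * u)) <= (log_factor (5 / 6 + v) + k * v) * u
    <= Rmin (k - k1) (k2 - k) * (v * u)).
  { intros v Hv. destruct (Hbetween v Hv) as (_ & Hvd & Hvu).
    apply Rabs_le_between. rewrite Rabs_mult, <- (Rabs_pos_eq (v * u)), Rabs_mult by assumption.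
    rewrite <- Rmult_assoc. apply Rmult_le_compat_r. apply Rabs_pos. now apply Hlin. }
  assert (Hm1 := Rmin_l (k - k1) (k2 - k)). assert (Hm2 := Rmin_r (k - k1) (k2 - k)).
  split.
  - destruct (Hquad k2) as (v & Hv1 & Ev). destruct (Hbetween v Hv1) as (_ & _ & Hvu).
    specialize (Hv v Hv1). nra.
  - destruct (Hquad k1) as (v & Hv1 & Ev). destruct (Hbetween v Hv1) as (_ & _ & Hvu).
    specialize (Hv v Hv1). nra.
Qed.

Lemma sine_factor_ge_1 (r l : nat) :
  1 / 6 <= INR l / INR r <= 5 / 6 -> 1 <= sine_factor r l.
Proof.
  intros Hx. unfold sine_factor. set (x := INR l / INR r) in *. assert (Hpi := PI_RGT_0).
  assert (H : sin (PI / 6) <= sin (PI * x)).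
  { destruct (Rle_dec x (1 / 2)).
    - apply sin_incr_1; nra.
    - rewrite <- (sin_PI_x (PI * x)). apply sin_incr_1; nra. }
  rewrite sin_PI6 in H. lra.
Qed.

Lemma sine_factor_le_1 (r l : nat) :
  0 <= INR l / INR r <= 1 / 6 \/ 5 / 6 <= INR l / INR r <= 1 -> sine_factor r l <= 1.
Proof.
  intros Hx. unfold sine_factor. set (x := INR l / INR r) in *. assert (Hpi := PI_RGT_0).
  assert (H : sin (PI * x) <= sin (PI / 6)).
  { destruct Hx as [Hx | Hx].
    - apply sin_incr_1; nra.
    - rewrite <- (sin_PI_x (PI * x)). apply sin_incr_1; nra. }
  rewrite sin_PI6 in H. lra.
Qed.

Lemma sine_prod_increases (r a m : nat) :
  (a <= m)%nat -> (m < r)%nat ->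
  (forall l, (a < l <= m)%nat -> 1 <= sine_factor r l) -> sine_prod r a <= sine_prod r m.
Proof.
  intros Ham. induction Ham as [| m Ham IH]; intros Hm Hf. lra.
  assert (H1 := IH ltac:(lia) (fun l Hl => Hf l ltac:(lia))).
  assert (H2 := Hf (S m) ltac:(lia)).
  assert (H3 := sine_prod_pos r m ltac:(lia)). simpl. nra.
Qed.

Lemma sine_prod_decreases (r a m : nat) :
  (a <= m)%nat -> (m < r)%nat ->
  (forall l, (a < l <= m)%nat -> sine_factor r l <= 1) -> sine_prod r m <= sine_prod r a.
Proof.
  intros Ham. induction Ham as [| m Ham IH]; intros Hm Hf. lra.
  assert (H1 := IH ltac:(lia) (fun l Hl => Hf l ltac:(lia))).
  assert (H2 := Hf (S m) ltac:(lia)).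
  assert (H3 := sine_prod_pos r m ltac:(lia)). simpl. nra.
Qed.

(** If [m] lies beyond the minimum near [r / 6], the product increases from [m]
    to [m1].  Otherwise it is at most 1, whereas at [m1] it is at least 1
    because it dominates its reflection and their product is [r]. *)
Lemma sine_prod_le_before_max (r m m1 : nat) :
  (m <= m1)%nat -> (r <= 2 * m1 + 1)%nat -> INR m1 / INR r <= 5 / 6 -> (m1 < r)%nat ->
  sine_prod r m <= sine_prod r m1.
Proof.
  intros Hm Hmid Hm1 Hr. set (n := INR r) in *.
  assert (Hn : 1 <= n) by (apply (le_INR 1); lia).
  apply (Rle_div_l _ _ n) in Hm1; [| lra].
  assert (Hincr : forall a, (a <= m1)%nat -> 1 / 6 * n <= INR a + 1 -> sine_prod r a <= sine_prod r m1).
  { intros a Ha Hna. apply sine_prod_increases; [assumption | assumption |].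
    intros l Hl. apply sine_factor_ge_1. fold n.
    assert (INR (S a) <= INR l <= INR m1) by (split; apply le_INR; lia).
    rewrite S_INR in *.
    split; [apply (Rle_div_r _ _ n) | apply (Rle_div_l _ _ n)]; lra. }
  destruct (Rle_dec (1 / 6 * n) (INR m + 1)) as [Hlow | Hlow].
  { now apply Hincr. }
  apply Rle_trans with 1.
  - change 1 with (sine_prod r 0). apply sine_prod_decreases. lia. lia.
    intros l Hl. apply sine_factor_le_1. left. fold n.
    assert (0 <= INR l <= INR m) by (split; [apply pos_INR | apply le_INR; lia]).
    split; [apply (Rle_div_r _ _ n) | apply (Rle_div_l _ _ n)]; lra.
  - assert (H := sine_prod_reflect r m1 Hr). fold n in H.
    assert (Hle : sine_prod r (r - 1 - m1) <= sine_prod r m1).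
    { apply Hincr. lia. rewrite !minus_INR by lia. fold n. simpl. lra. }
    assert (H1 := sine_prod_pos r m1 Hr).
    assert (H2 := sine_prod_pos r (r - 1 - m1) ltac:(lia)). nra.
Qed.

Lemma sine_prod_le_after_max (r m m2 : nat) :
  (m2 <= m)%nat -> 5 / 6 <= INR (S m2) / INR r -> (m < r)%nat ->
  sine_prod r m <= sine_prod r m2.
Proof.
  intros Hm Hm2 Hr. set (n := INR r) in *.
  assert (Hn : 1 <= n) by (apply (le_INR 1); lia).
  apply (Rle_div_r _ _ n) in Hm2; [| lra].
  apply sine_prod_decreases; [assumption | assumption |].
  intros l Hl. apply sine_factor_le_1. right. fold n.
  assert (INR (S m2) <= INR l) by (apply le_INR; lia).
  assert (INR l <= n) by (apply le_INR; lia).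
  split; [apply (Rle_div_r _ _ n) | apply (Rle_div_l _ _ n)]; lra.
Qed.

(** * Gaussian concentration of the summands *)

(** The normalization divides by [r * exp (r Vol / (2 PI))], the size of the
    largest summand. *)
Definition normalized_summand (r m : nat) : R :=
  sine_prod r m ^ 2 / INR r * exp (- (INR r * (Vol_fig8 / (2 * PI)))).

Definition gauss_weight (k : R) (r m : nat) : R :=
  exp (- k * (INR m + 1 / 2 - 5 / 6 * INR r) ^ 2 / INR r).

Lemma gauss_weight_midpoint (k : R) (r m : nat) :
  (1 <= r)%nat -> gauss_weight k r m = exp (- k * (midpoint r m - 5 / 6) ^ 2 * INR r).
Proof.
  intros Hr. assert (INR r <> 0) by (apply not_0_INR; lia).
  unfold gauss_weight, midpoint. f_equal. field. assumption.
Qed.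

Lemma normalized_summand_le (r a m : nat) :
  (1 <= r)%nat -> (m < r)%nat -> sine_prod r m <= sine_prod r a ->
  normalized_summand r m <= normalized_summand r a.
Proof.
  intros Hr Hm H. unfold normalized_summand.
  assert (0 < INR r) by (apply lt_0_INR; lia).
  apply Rmult_le_compat_r. left; apply exp_pos.
  apply Rmult_le_compat_r. left; now apply Rinv_0_lt_compat.
  apply pow_incr. split; [| assumption]. left. now apply sine_prod_pos.
Qed.

Lemma normalized_summand_near (k1 k2 : R) :
  k1 < PI * sqrt 3 < k2 ->
  exists d C R0, 0 < d < 1 / 24 /\ 0 <= C /\ forall r m : nat,
    R0 <= INR r -> Rabs (midpoint r m - 5 / 6) <= d ->
    gauss_weight k2 r m <= normalized_summand r m <= exp (C / INR r) * gauss_weight k1 r m.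
Proof.
  intros Hk.
  destruct (potential_quadratic k1 k2 Hk) as (d & Hd & Hquad).
  destruct sine_prod_sqr_estimate as (C & R0 & HC & Hest).
  exists d, C, (Rmax 1 R0). split; [assumption |]. split; [assumption |].
  intros r m HR Hu.
  assert (HR1 : 1 <= INR r) by (eapply Rle_trans; [apply Rmax_l | exact HR]).
  assert (HR2 : R0 <= INR r) by (eapply Rle_trans; [apply Rmax_r | exact HR]).
  assert (Hr : (1 <= r)%nat) by (apply INR_le; simpl; lra).
  rewrite !gauss_weight_midpoint by assumption.
  unfold normalized_summand. rewrite <- potential_max.
  specialize (Hquad _ Hu).
  replace (5 / 6 + (midpoint r m - 5 / 6)) with (midpoint r m) in Hquad by ring.
  apply Rabs_le_between in Hu.
  destruct (Hest r m HR2) as [H1 H2].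
  { lra. }
  { apply Rle_trans with (midpoint r m); [| lra]. unfold midpoint, Rdiv.
    apply Rmult_le_compat_r. left; apply Rinv_0_lt_compat; lra. lra. }
  set (n := INR r) in *. set (p := potential (midpoint r m)) in *.
  set (q := potential (5 / 6)) in *. set (u := midpoint r m - 5 / 6) in *.
  set (e := exp (- (n * (2 * q)))).
  assert (He : exp (2 * n * p) * e = exp (n * (2 * p - 2 * q))).
  { unfold e. rewrite <- exp_plus. f_equal. ring. }
  assert (He0 : 0 < e) by apply exp_pos.
  assert (Hsq : forall s, s / n * e * n = s * e) by (intros; field; lra).
  assert (Hn : 0 < / n) by (apply Rinv_0_lt_compat; lra).
  split.
  - apply Rle_trans with (exp (2 * n * p) * e).
    + rewrite He. apply exp_monotone. nra.
    + apply Rmult_le_compat_r. lra. apply (Rle_div_r _ _ n); lra.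
  - apply Rle_trans with (exp (C / n) * (exp (2 * n * p) * e)).
    + rewrite <- Rmult_assoc. apply Rmult_le_compat_r. lra.
      apply (Rle_div_l _ _ n); lra.
    + apply Rmult_le_compat_l. left; apply exp_pos.
      rewrite He. apply exp_monotone. nra.
Qed.

(** Far from the peak, on either side, a summand is dominated by one whose
    midpoint is at distance between [d / 2] and [d] from [5 / 6]; that one is
    covered by the Gaussian estimate and is therefore exponentially small. *)
Lemma normalized_summand_bounds (k1 k2 : R) :
  0 < k1 < PI * sqrt 3 -> PI * sqrt 3 < k2 ->
  exists eta C R0, 0 < eta /\ 0 <= C /\ forall r m : nat,
    R0 <= INR r -> (m < r)%nat ->
    gauss_weight k2 r m - exp (- (eta * INR r)) <= normalized_summand r m
    <= exp (C / INR r) * (gauss_weight k1 r m + exp (- (eta * INR r))).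
Proof.
  intros Hk1 Hk2.
  destruct (normalized_summand_near k1 k2) as (d & C & R0 & Hd & HC & Hnear). lra.
  exists (k1 * (d / 2) ^ 2), C, (Rmax (2 / d) R0).
  assert (Hd2 : 0 < (d / 2) ^ 2) by (apply pow_lt; lra).
  split. nra. split. assumption.
  intros r m HR Hm.
  assert (HR1 : 2 / d <= INR r) by (eapply Rle_trans; [apply Rmax_l | exact HR]).
  assert (HR2 : R0 <= INR r) by (eapply Rle_trans; [apply Rmax_r | exact HR]).
  assert (Hr : (1 <= r)%nat) by lia.
  apply (Rle_div_l _ _ d) in HR1; [| lra].
  set (n := INR r) in *.
  assert (Hn : 0 < n) by (apply lt_0_INR; lia).
  set (E := exp (- (k1 * (d / 2) ^ 2 * n))).
  assert (HE : 0 < E) by apply exp_pos.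
  destruct (Rle_dec (Rabs (midpoint r m - 5 / 6)) d) as [Hu | Hu].
  - destruct (Hnear r m HR2 Hu) as [H1 H2]. fold n in H2. split. lra.
    eapply Rle_trans. exact H2. apply Rmult_le_compat_l. left; apply exp_pos. lra.
  - split.
    + apply Rle_trans with 0.
      * apply Rle_minus. rewrite gauss_weight_midpoint by assumption.
        apply exp_monotone. fold n. set (u := midpoint r m - 5 / 6) in *.
        assert (d ^ 2 <= u ^ 2) by (rewrite <- (pow2_abs u); apply pow_incr; lra).
        assert (k1 * (d / 2) ^ 2 <= k2 * u ^ 2).
        { apply Rmult_le_compat; lra. }
        assert (k1 * (d / 2) ^ 2 * n <= k2 * u ^ 2 * n) by (apply Rmult_le_compat_r; lra).
        lra.
      * unfold normalized_summand. apply Rmult_le_pos; [| left; apply exp_pos].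
        apply Rdiv_le_0_compat. apply pow2_ge_0. assumption.
    + assert (Hfar : exists a, normalized_summand r m <= normalized_summand r a /\
        d / 2 <= Rabs (midpoint r a - 5 / 6) <= d).
      { apply Rnot_le_lt in Hu.
        assert (Emid : forall a, midpoint r a * n = INR a + 1 / 2)
          by (intros; unfold midpoint; fold n; field; lra).
        (* The midpoint of the floor [a] chosen below is farther from [5/6] than
           [5/6 + d/2] or [5/6 - d/2], by at most [1 / r <= d / 2]. *)
        destruct (Rle_dec 0 (midpoint r m - 5 / 6)) as [Hs | Hs].
        - rewrite Rabs_pos_eq in Hu by assumption.
          destruct (nfloor_ex ((5 / 6 + d / 2) * n + 1 / 2)) as [a Ha]. nra.
          assert (Ea := Emid a). assert (Em := Emid m).
          assert (5 / 6 + d / 2 <= midpoint r a) by (apply Rmult_le_reg_r with n; lra).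
          assert (midpoint r a <= 5 / 6 + d) by (apply Rmult_le_reg_r with n; lra).
          exists a. split.
          + apply normalized_summand_le; [assumption | assumption |].
            apply sine_prod_le_after_max; [| | assumption].
            * apply INR_le. nra.
            * fold n. apply (Rle_div_r _ _ n). lra. rewrite S_INR. nra.
          + rewrite Rabs_pos_eq; lra.
        - rewrite Rabs_left in Hu by lra.
          destruct (nfloor_ex ((5 / 6 - d / 2) * n - 1 / 2)) as [a Ha]. nra.
          assert (Ea := Emid a). assert (Em := Emid m).
          assert (5 / 6 - d <= midpoint r a) by (apply Rmult_le_reg_r with n; lra).
          assert (midpoint r a <= 5 / 6 - d / 2) by (apply Rmult_le_reg_r with n; lra).
          assert (Har : (a < r)%nat) by (apply INR_lt; fold n; nra).
          exists a. split.
          + apply normalized_summand_le; [assumption | assumption |].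
            apply sine_prod_le_before_max; [| | | assumption].
            * apply INR_le. nra.
            * apply INR_le. rewrite plus_INR, mult_INR. fold n. simpl. nra.
            * fold n. apply (Rle_div_l _ _ n). lra. nra.
          + rewrite Rabs_left; lra. }
      destruct Hfar as (a & Ha & Hua).
      eapply Rle_trans. exact Ha.
      destruct (Hnear r a HR2) as [_ H]. lra. fold n in H.
      eapply Rle_trans. exact H. apply Rmult_le_compat_l. left; apply exp_pos.
      assert (gauss_weight k1 r a <= E).
      { rewrite gauss_weight_midpoint by assumption. apply exp_monotone. fold n.
        set (u := midpoint r a - 5 / 6) in *.
        assert ((d / 2) ^ 2 <= u ^ 2) by (rewrite <- (pow2_abs u); apply pow_incr; lra).
        assert (k1 * (d / 2) ^ 2 * n <= k1 * u ^ 2 * n).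
        { apply Rmult_le_compat_r. lra. apply Rmult_le_compat_l; lra. }
        lra. }
      assert (0 < gauss_weight k1 r m) by apply exp_pos. lra.
Qed.

Lemma exponential_tail_lim (eta : R) :
  0 < eta -> is_lim_seq (fun r => INR r * exp (- (eta * INR r)) / sqrt (INR r)) 0.
Proof.
  intros Heta.
  apply is_lim_seq_le_le_loc with (fun _ => 0) (fun r => / eta * / sqrt (INR r)).
  - exists 1%nat. intros r Hr.
    assert (Hn : 0 < INR r) by (apply lt_0_INR; lia).
    assert (Hq : 0 < sqrt (INR r)) by now apply sqrt_lt_R0.
    assert (He := exp_pos (- (eta * INR r))).
    split.
    + apply Rdiv_le_0_compat; [| assumption]. apply Rmult_le_pos; lra.
    + apply Rmult_le_compat_r. left; now apply Rinv_0_lt_compat.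
      assert (H1 : exp (- (eta * INR r)) * exp (eta * INR r) = 1)
        by (rewrite <- exp_plus, Rplus_opp_l; apply exp_0).
      assert (H2 := exp_ineq1_le (eta * INR r)).
      apply Rmult_le_reg_l with eta. assumption. rewrite Rinv_r by lra. nra.
  - apply is_lim_seq_const.
  - replace (Finite 0) with (Rbar_mult (/ eta) 0) by (simpl; f_equal; ring).
    apply is_lim_seq_scal_l, inv_sqrt_INR_lim.
Qed.

Lemma normalized_sum_squeeze (k1 k2 : R) :
  0 < k1 < PI * sqrt 3 -> PI * sqrt 3 < k2 ->
  exists lower upper : nat -> R,
    is_lim_seq lower (sqrt (PI / k2)) /\ is_lim_seq upper (sqrt (PI / k1)) /\
    eventually (fun r =>
      lower r <= sum_n (normalized_summand r) (r - 1) / sqrt (INR r) <= upper r).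
Proof.
  intros Hk1 Hk2.
  destruct (normalized_summand_bounds k1 k2 Hk1 Hk2) as (eta & C & R0 & Heta & HC & Hb).
  set (G k r := sum_n (gauss_weight k r) (r - 1) / sqrt (INR r)).
  set (tail r := INR r * exp (- (eta * INR r)) / sqrt (INR r)).
  assert (HG : forall k, 0 < k -> is_lim_seq (G k) (sqrt (PI / k))).
  { intros k Hk. apply gauss_sum_lim; lra. }
  assert (Htail : is_lim_seq tail 0) by now apply exponential_tail_lim.
  exists (fun r => G k2 r - tail r), (fun r => exp (C / INR r) * (G k1 r + tail r)).
  split; [| split].
  - replace (Finite (sqrt (PI / k2))) with (Finite (sqrt (PI / k2) - 0)) by (f_equal; ring).
    apply is_lim_seq_minus'. apply HG; lra. assumption.
  - replace (Finite (sqrt (PI / k1))) with (Finite (1 * (sqrt (PI / k1) + 0))) by (f_equal; ring).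
    apply is_lim_seq_mult'.
    + rewrite <- exp_0. apply (is_lim_seq_continuous exp (fun r => C / INR r) 0).
      * apply continuity_pt_filterlim, continuous_exp.
      * replace (Finite 0) with (Rbar_mult C 0) by (simpl; f_equal; ring).
        apply is_lim_seq_scal_l, inv_INR_lim.
    + apply is_lim_seq_plus'. apply HG; lra. assumption.
  - destruct (nfloor_ex (Rmax 1 R0)) as [N0 HN0]. generalize (Rmax_l 1 R0); lra.
    exists (S N0). intros r Hr.
    assert (HN : Rmax 1 R0 <= INR r).
    { apply le_INR in Hr. rewrite S_INR in Hr. lra. }
    assert (HR1 : 1 <= INR r) by (eapply Rle_trans; [apply Rmax_l | exact HN]).
    assert (HR0 : R0 <= INR r) by (eapply Rle_trans; [apply Rmax_r | exact HN]).
    assert (Hq : 0 < / sqrt (INR r)) by (apply Rinv_0_lt_compat, sqrt_lt_R0; lra).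
    assert (Er : S (r - 1) = r) by lia.
    unfold G, tail. split.
    + unfold Rdiv. rewrite <- Rmult_minus_distr_r. apply Rmult_le_compat_r. lra.
      replace (_ - _) with
        (sum_n (fun m => gauss_weight k2 r m + - exp (- (eta * INR r))) (r - 1)).
      2:{ rewrite <- sum_n_plus_const, Er. apply Rminus_diag_uniq. ring. }
      apply sum_n_le_compat. intros m Hm. destruct (Hb r m HR0). lia. lra.
    + unfold Rdiv. rewrite <- Rmult_plus_distr_r, <- Rmult_assoc. apply Rmult_le_compat_r. lra.
      replace (_ + _) with
        (sum_n (fun m => gauss_weight k1 r m + exp (- (eta * INR r))) (r - 1)).
      2:{ rewrite <- sum_n_plus_const, Er. apply Rminus_diag_uniq. ring. }
      rewrite <- sum_n_scal.
      apply sum_n_le_compat. intros m Hm. destruct (Hb r m HR0). lia. assumption.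
Qed.

(** The squeeze holds for all [k1] and [k2] around [PI sqrt 3], and
    [sqrt (PI / k)] is continuous in [k]. *)
Lemma normalized_sum_lim :
  is_lim_seq (fun r => sum_n (normalized_summand r) (r - 1) / sqrt (INR r))
    (sqrt (PI / (PI * sqrt 3))).
Proof.
  assert (Hpi := PI_RGT_0).
  assert (Hs3 : 0 < sqrt 3) by (apply sqrt_lt_R0; lra).
  set (k := PI * sqrt 3).
  assert (Hk : 0 < k) by (apply Rmult_lt_0_compat; lra).
  apply is_lim_seq_spec. intros eps.
  assert (Hcont : continuous (fun k => sqrt (PI / k)) k).
  { apply (ex_derive_continuous (fun k => sqrt (PI / k))). auto_derive.
    split. lra. split; [| exact I]. apply Rdiv_lt_0_compat; lra. }
  assert (Hloc := proj1 (filterlim_locally _ _) Hcont (pos_div_2 eps)).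
  destruct Hloc as [d Hd].
  assert (Hd0 := cond_pos d).
  set (h := Rmin (d / 2) (k / 2)).
  assert (Hh : 0 < h) by (apply Rmin_glb_lt; lra).
  assert (Hh1 : h <= d / 2) by apply Rmin_l. assert (Hh2 : h <= k / 2) by apply Rmin_r.
  destruct (normalized_sum_squeeze (k - h) (k + h)) as (lower & upper & Hl & Hu & Hev);
    fold k; try lra.
  assert (D1 : Rabs (sqrt (PI / (k - h)) - sqrt (PI / k)) < eps / 2).
  { apply (Hd (k - h)). change (Rabs (k - h - k) < d). rewrite Rabs_left; lra. }
  assert (D2 : Rabs (sqrt (PI / (k + h)) - sqrt (PI / k)) < eps / 2).
  { apply (Hd (k + h)). change (Rabs (k + h - k) < d). rewrite Rabs_pos_eq; lra. }
  apply is_lim_seq_spec in Hl. apply is_lim_seq_spec in Hu.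
  assert (Hl' := Hl (pos_div_2 eps)). assert (Hu' := Hu (pos_div_2 eps)).
  generalize (filter_and _ _ Hev (filter_and _ _ Hl' Hu')).
  apply filter_imp. intros r (H1 & H2 & H3). simpl in H2, H3.
  apply Rabs_lt_between in D1. apply Rabs_lt_between in D2.
  apply Rabs_lt_between in H2. apply Rabs_lt_between in H3.
  apply Rabs_lt_between. lra.
Qed.

Lemma leading_constant : sqrt (PI / (PI * sqrt 3)) = Rpower 3 (- (1 / 4)).
Proof.
  assert (Hpi := PI_RGT_0).
  assert (Hs3 : 0 < sqrt 3) by (apply sqrt_lt_R0; lra).
  replace (PI / (PI * sqrt 3)) with (Rpower 3 (- (1 / 4)) ^ 2).
  - apply sqrt_pow2. left. apply exp_pos.
  - replace (PI / (PI * sqrt 3)) with (/ sqrt 3) by (field; lra).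
    rewrite <- Rpower_sqrt, <- Rpower_Ropp, <- Rsqr_pow2 by lra. unfold Rsqr.
    rewrite <- Rpower_plus. f_equal. field.
Qed.

Theorem theorem1 :
  asymp_equiv
    (fun r : nat => colored_Jones_fig8 r r)
    (fun r : nat =>
       RtoC (Rpower 3 (- (1 / 4)) * Rpower (INR r) (3 / 2)
             * exp (INR r / (2 * PI) * Vol_fig8))).
Proof.
  assert (Hpi := PI_RGT_0).
  set (c := Rpower 3 (- (1 / 4))).
  assert (Hc : 0 < c) by apply exp_pos.
  assert (Hlim : is_lim_seq (fun r => sum_n (normalized_summand r) (r - 1) / sqrt (INR r) / c) 1).
  { replace (Finite 1) with (Finite (c / c)) by (f_equal; field; lra).
    apply is_lim_seq_div'; [| apply is_lim_seq_const | lra].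
    unfold c. rewrite <- leading_constant. apply normalized_sum_lim. }
  unfold asymp_equiv.
  apply filterlim_ext_loc with
    (fun r => RtoC (sum_n (normalized_summand r) (r - 1) / sqrt (INR r) / c)).
  - exists 1%nat. intros r Hr.
    assert (Hn : 0 < INR r) by (apply lt_0_INR; lia).
    assert (Hq : 0 < sqrt (INR r)) by now apply sqrt_lt_R0.
    rewrite colored_Jones_top by assumption.
    replace (Rpower (INR r) (3 / 2)) with (INR r * sqrt (INR r)).
    2:{ replace (3 / 2) with (1 + / 2) by field.
        now rewrite Rpower_plus, Rpower_1, Rpower_sqrt. }
    set (x := INR r / (2 * PI) * Vol_fig8).
    assert (Hx := exp_pos x).
    rewrite <- RtoC_div.
    2:{ apply Rgt_not_eq. apply Rmult_lt_0_compat; [| assumption].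
        apply Rmult_lt_0_compat; [assumption |]. now apply Rmult_lt_0_compat. }
    f_equal.
    rewrite (sum_n_ext (normalized_summand r)
      (fun m => / (INR r * exp x) * sine_prod r m ^ 2)).
    + rewrite sum_n_scal. field. lra.
    + intros m. unfold normalized_summand.
      replace (INR r * (Vol_fig8 / (2 * PI))) with x by (unfold x; field; lra).
      rewrite exp_Ropp. apply Rminus_diag_uniq. field. lra.
  - apply filterlim_locally. intros eps.
    assert (H := proj1 (filterlim_locally _ _) Hlim eps).
    revert H. apply filter_imp. intros r H.
    split. exact H. simpl. apply ball_center.
Qed.
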